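(* Let $\gamma$ be a simple closed curve in the Euclidean plane $\mathbb{R}^2$ with length $L$, and let $A$ be the area of the region bounded by $\gamma$. Then $$L^2 \geq 4\pi A,$$ and equality holds if and only if $\gamma$ is a circle.
   Context: A simple closed curve in the plane is a continuous closed curve without self-intersections. Having length $L$ means that the curve is rectifiable with finite length $L$. The region bounded by $\gamma$ is the bounded region of the plane enclosed by $\gamma$, and its area is its two-dimensional area (Lebesgue measure). *)

(* Defs.v *)
From HB Require Import structures.
From mathcomp Require Import all_boot all_order all_algebra.
From mathcomp Require Import all_classical all_reals all_analysis.

Set Implicit Arguments.
Unset Strict Implicit.
Unset Printing Implicit Defensive.

Import Order.TTheory GRing.Theory Num.Theory.
Import numFieldNormedType.Exports.

Local Open Scope classical_set_scope.
Local Open Scope ring_scope.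

(* The library norm on R * R is the max norm: it induces the usual topology and
   bounded sets, but lengths and circles need the Euclidean distance. *)
Definition edist (R : realType) (p q : R * R) : R :=
  Num.sqrt ((p.1 - q.1) ^+ 2 + (p.2 - q.2) ^+ 2).

Definition simple_closed_curve (R : realType) (a b : R) (gamma : R -> R * R) :
    Prop :=
  [/\ {within `[a, b], continuous gamma},
      gamma a = gamma b &
      {in `[a, b[ &, injective gamma}].

(* As in [variation], the subdivision is a :: s, where the last element of s
   is b; [itv_partition] makes it strictly increasing. *)
Definition polygon_length (R : realType) (a b : R) (gamma : R -> R * R)
    (s : seq R) : R :=
  let G := gamma \o nth b (a :: s) in
  \sum_(0 <= n < size s) edist (G n.+1) (G n).

Definition curve_length (R : realType) (a b : R) (gamma : R -> R * R) : \bar R :=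
  ereal_sup [set (polygon_length a b gamma s)%:E | s in itv_partition a b].

Definition curve_image (R : realType) (a b : R) (gamma : R -> R * R) : set (R * R) :=
  gamma @` `[a, b].

(* The union of the bounded connected components of the complement of the image;
   by the Jordan curve theorem there is exactly one when the curve is simple
   and closed. *)
Definition enclosed_region (R : realType) (a b : R) (gamma : R -> R * R) :
    set (R * R) :=
  [set p | (~` curve_image a b gamma) p /\
           bounded_set (connected_component (~` curve_image a b gamma) p)].

Definition area (R : realType) (E : set (R * R)) : \bar R :=
  ((@lebesgue_measure R) \x (@lebesgue_measure R))%E E.

Definition is_circle (R : realType) (E : set (R * R)) : Prop :=
  exists (c : R * R) (r : R), 0 < r /\ E = [set p | edist p c = r].

(* Main.v *)
Require Import Defs.
From mathcomp Require Import all_boot all_order all_algebra.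
From mathcomp Require Import all_classical all_reals all_analysis.
From mathcomp Require Import measurable_realfun.
From mathcomp Require Import ring lra zify.
Set Implicit Arguments.
Unset Strict Implicit.
Unset Printing Implicit Defensive.
Import Order.TTheory GRing.Theory Num.Theory.
Import numFieldNormedType.Exports.
Local Open Scope classical_set_scope.
Local Open Scope ring_scope.

(** Why the theorem is true.  The proof is the Fourier proof of Hurwitz and
Minkowski, carried out on finitely many directions, where the integrals become
finite sums, and then on finer and finer grids of directions.

Let f th be the support function of the curve, the largest height of one of
its points in the direction th, measured from the base point gamma a.  A
point that is higher than the whole curve in some direction can be moved to
infinity along a ray; so the enclosed region lies in the intersection of all
the supporting half-planes ([enclosed_height]).  Keep only the N = 2 M
directions k * al, where al = 2 pi / N.  The resulting circumscribed polygon
splits into triangles, and its area is a quadratic form in the numbers f (k al)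
([area_polygon_le]):
  area <= (1 / sin al) sum_k (f_k f_(k+1) - cos al f_k ^ 2).

The discrete Fourier transform diagonalizes this form.  The mean of f has a
positive coefficient, the modes of frequency 1, which correspond to
translations, have coefficient 0, and all the others are negative, with a
uniform gap ([fourier_gap], [fourier_residual]).  The mean itself is bounded
by the length: in each direction a closed curve varies by at least twice its
width, and averaging over the directions recovers the length
([curve_perimeter], a discrete Cauchy-Crofton formula).  Together
([isoperimetric_gap]):
  2 N (sin al * area + (cos al - cos (2 al)) * G) <= L ^ 2,
where G is the squared distance on the grid from f to the functions
c + u cos + v sin.  As N grows, 2 N sin al tends to 4 pi, and the inequality
follows.

If equality holds, then G is at most (al - sin al) L ^ 2 / 4 pi divided by
cos al - cos (2 al), hence of order al ([small_angle], [near_circle]).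
Therefore f is exactly of the form c + u cos + v sin: it is the support
function of a disc.  So the curve lies in that disc, and it must reach each
point of the boundary circle, since it touches all the supporting lines
([equality_disc]).  A simple closed curve that covers a circle has no room to
leave it: deleting a point does not disconnect the circle, but deleting two
points disconnects the curve ([one_side], [simple_curve_on_circle]).

Conversely, let the image be a circle of radius r.  Stereographic projection
from gamma a is continuous and injective along the curve, so the polar angle
is monotone, and inscribed polygons are no longer than 2 pi r
([monotone_angle], [circle_length]).  The open disc is enclosed, and its area
is at least pi r ^ 2 ([disc_sub_enclosed], [circle_area]).  With the
inequality already proved, L ^ 2 <= 4 pi area <= L ^ 2. *)

(** * Trigonometric sums *)

Lemma cos_per (R : realType) (x : R) n : cos (x + n%:R * (2 * pi)) = cos x.
Proof.
have -> : n%:R * (2 * pi) = (pi *+ 2) *+ n :> R.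
  by rewrite [LHS]mulr_natl [2 * pi]mulr_natl.
exact: (periodicn (@cosD2pi R)).
Qed.

Lemma sin_per (R : realType) (x : R) n : sin (x + n%:R * (2 * pi)) = sin x.
Proof.
have -> : n%:R * (2 * pi) = (pi *+ 2) *+ n :> R.
  by rewrite [LHS]mulr_natl [2 * pi]mulr_natl.
exact: (periodicn (@sinD2pi R)).
Qed.

(** By the product-to-sum formula each term, once multiplied by 2 sin (b / 2),
    is a difference of two consecutive sines. *)
Lemma sum_cos_telescope (R : realType) (x b : R) n :
  2 * sin (b / 2) * \sum_(m < n) cos (x + m%:R * b) =
  sin (x + n%:R * b - b / 2) - sin (x - b / 2).
Proof.
elim: n => [|n IH]; first by rewrite big_ord0 mulr0 mul0r addr0 subrr.
rewrite big_ord_recr /= mulrDr IH.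
have -> : x + n.+1%:R * b - b / 2 = (x + n%:R * b) + b / 2.
  by rewrite -natr1; field.
rewrite (sinB (x + n%:R * b)) (sinD (x + n%:R * b)); ring.
Qed.

(** The telescoped sum compares two sines at arguments that differ by d full
    turns; the factor sin (b / 2) does not vanish since 0 < d < N. *)
Lemma sum_cos_eq0 (R : realType) (N d : nat) (x : R) : (0 < d < N)%N ->
  \sum_(m < N) cos (x + m%:R * (d%:R * (2 * pi / N%:R))) = 0.
Proof.
move=> /andP[d0 dN]; set b := d%:R * _.
have N0 : N%:R != 0 :> R by rewrite pnatr_eq0 -lt0n (leq_trans _ dN).
have sb : 0 < sin (b / 2).
  apply: sin_gt0_pi; rewrite /b.
  have -> : d%:R * (2 * pi / N%:R) / 2 = pi * (d%:R / N%:R) :> R by field.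
  have N1 : (0 < N)%N by rewrite (leq_trans _ dN).
  have Np : 0 < N%:R :> R by rewrite ltr0n.
  rewrite mulr_gt0 ?pi_gt0 ?divr_gt0 ?ltr0n //=.
  by rewrite gtr_pMr ?pi_gt0 // ltr_pdivrMr // mul1r ltr_nat.
have := sum_cos_telescope x b N.
have -> : x + N%:R * b - b / 2 = (x - b / 2) + d%:R * (2 * pi).
  by rewrite /b; field.
rewrite sin_per subrr => /eqP; rewrite mulf_eq0 => /orP[|/eqP //].
by rewrite mulf_eq0 (gt_eqF sb) orbF pnatr_eq0.
Qed.

Lemma sum_sin_eq0 (R : realType) (N d : nat) (x : R) : (0 < d < N)%N ->
  \sum_(m < N) sin (x + m%:R * (d%:R * (2 * pi / N%:R))) = 0.
Proof.
move=> dN; rewrite -[RHS](sum_cos_eq0 (x - pi / 2) dN).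
by apply: eq_bigr => m _; rewrite addrAC cosBpihalf.
Qed.

(** * The discrete Fourier transform *)

(** Families indexed by the integers modulo N are kept as functions on nat, so
    that shifts of the index need no modular arithmetic. *)
Definition cyclic (T : Type) (N : nat) (F : nat -> T) := forall k, F (k + N)%N = F k.

Lemma cyclic_shift (R : realType) N (F : nat -> R) j : cyclic N F ->
  \sum_(k < N) F (k + j)%N = \sum_(k < N) F k.
Proof.
move=> cF; elim: j => [|j <-]; first by apply: eq_bigr => k _; rewrite addn0.
case: N cF => [|N] cF; first by rewrite !big_ord0.
rewrite big_ord_recr [in RHS]big_ord_recl /= addrC; congr (_ + _).
  by rewrite addnS -addSn addnC cF add0n.
by apply: eq_bigr => k _; rewrite /bump /= addnS add1n addSn.
Qed.

(** The area of a polygon with equally spaced normals depends on its support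
    numbers only through the values of their autocorrelation at 0 and 1. *)
Definition autocorr (R : realType) (N : nat) (F : nat -> R) j :=
  \sum_(k < N) F k * F (k + j)%N.

Lemma autocorr_pred (R : realType) N (F : nat -> R) : (0 < N)%N -> cyclic N F ->
  autocorr N F N.-1 = autocorr N F 1.
Proof.
move=> N0 cF; rewrite /autocorr.
rewrite -(@cyclic_shift _ N (fun k => F k * F (k + N.-1)%N) 1).
  by apply: eq_bigr => k _; rewrite -addnA add1n prednK // cF mulrC.
by move=> k; rewrite addnAC !cF.
Qed.

Section DFT.
Variables (R : realType) (N : nat) (F : nat -> R).
Hypothesis cF : cyclic N F.
Hypothesis N4 : (4 <= N)%N.
Let al : R := 2 * pi / N%:R.

Let c := autocorr N F.
Let A m := \sum_(k < N) F k * cos (k%:R * (m%:R * al)).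
Let B m := \sum_(k < N) F k * sin (k%:R * (m%:R * al)).
(** A and B are, up to sign, the real and imaginary parts of the discrete Fourier
    transform, and p is the power spectrum. *)
Let p m := A m ^+ 2 + B m ^+ 2.

Let N0 : N%:R != 0 :> R. Proof. by rewrite pnatr_eq0 -lt0n (leq_trans _ N4). Qed.
Let Nal : N%:R * al = 2 * pi. Proof. by rewrite /al; field. Qed.

Let p_ge0 m : 0 <= p m. Proof. by rewrite addr_ge0 ?sqr_ge0. Qed.

(** Discrete Wiener-Khinchin formula: the double sum over k and l is arranged
    by the difference j = l - k, which periodicity allows. *)
Let power_spectrumE m : p m = \sum_(j < N) c j * cos (j%:R * (m%:R * al)).
Proof.
have -> : p m = \sum_(k < N) \sum_(l < N)
    F k * F l * cos (l%:R * (m%:R * al) - k%:R * (m%:R * al)).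
  rewrite /p !expr2 /A /B !big_distrlr /= -big_split /=; apply: eq_bigr => k _.
  rewrite -big_split /=; apply: eq_bigr => l _; rewrite cosB; ring.
under [RHS]eq_bigr => j _ do rewrite /c /autocorr mulr_suml.
rewrite [RHS]exchange_big /=; apply: eq_bigr => k _.
rewrite -(@cyclic_shift _ N (fun l => F k * F l *
   cos (l%:R * (m%:R * al) - k%:R * (m%:R * al))) k); last first.
  move=> l; rewrite cF; congr (_ * _).
  rewrite natrD mulrDl (mulrCA N%:R) Nal addrAC.
  by rewrite cos_per.
apply: eq_bigr => j _; rewrite (addnC j k); congr (_ * cos _).
rewrite natrD; ring.
Qed.

(** Orthogonality of the characters: summed over m, the cosines of all the
    nonzero j cancel. *)
Let inverse_transform0 d : cyclic N d ->
  \sum_(m < N) \sum_(j < N) d j * cos (j%:R * (m%:R * al)) = N%:R * d 0%N.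
Proof.
move=> cd; rewrite exchange_big /=.
have N1 : (0 < N)%N by rewrite (leq_trans _ N4).
rewrite (bigD1 (Ordinal N1)) //= [X in _ + X]big1 ?addr0.
  under eq_bigr => m _ do rewrite mul0r cos0 mulr1.
  by rewrite sumr_const card_ord mulr_natl.
move=> j j0; rewrite -mulr_sumr.
under eq_bigr => m _ do rewrite mulrCA -[X in cos X]add0r.
rewrite sum_cos_eq0 ?mulr0 // ltn_ord andbT lt0n.
by apply: contra j0 => /eqP j0; apply/eqP/val_inj.
Qed.

Let autocorr_cyclic : cyclic N c.
Proof. by move=> k; apply: eq_bigr => l _; rewrite addnA cF. Qed.

Let cos_cyclic m k : cos ((k + N)%:R * (m%:R * al)) = cos (k%:R * (m%:R * al)).
Proof. by rewrite natrD mulrDl (mulrCA N%:R) Nal cos_per. Qed.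

Let sum_spectrum : \sum_(m < N) p m = N%:R * c 0%N.
Proof. by under eq_bigr => m _ do rewrite power_spectrumE; rewrite inverse_transform0. Qed.

(** Multiplying by the cosine shifts the index of the autocorrelation by one
    step in both directions, and the two shifts agree by symmetry. *)
Let sum_spectrum_cos : \sum_(m < N) p m * cos (m%:R * al) = N%:R * c 1%N.
Proof.
have N1 : (0 < N)%N by rewrite (leq_trans _ N4).
have E m : p m * cos (m%:R * al) =
    2^-1 * (\sum_(j < N) c (j + N.-1)%N * cos (j%:R * (m%:R * al)))
  + 2^-1 * (\sum_(j < N) c (j + 1)%N * cos (j%:R * (m%:R * al))).
  rewrite power_spectrumE mulr_suml.
  transitivity (\sum_(j < N) (2^-1 * (c j * cos (j.+1%:R * (m%:R * al))) +
       2^-1 * (c j * cos (j%:R * (m%:R * al) - m%:R * al)))).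
    apply: eq_bigr => j _; rewrite -[j.+1%:R]natr1 (mulrDl j%:R) mul1r cosD cosB.
    by field.
  rewrite big_split /= -!mulr_sumr; congr (_ * _ + _ * _).
    rewrite -[RHS](@cyclic_shift _ N
      (fun j => c (j + N.-1)%N * cos (j%:R * (m%:R * al))) 1); last first.
      by move=> k; rewrite addnAC autocorr_cyclic cos_cyclic.
    by apply: eq_bigr => j _; rewrite -addnA add1n prednK // autocorr_cyclic addn1.
  rewrite -[LHS](@cyclic_shift _ N
      (fun j => c j * cos (j%:R * (m%:R * al) - m%:R * al)) 1); last first.
    by move=> k; rewrite autocorr_cyclic natrD mulrDl (mulrCA N%:R) Nal addrAC cos_per.
  by apply: eq_bigr => j _; rewrite natrD mulrDl mul1r addrK.
under eq_bigr => m _ do rewrite E.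
rewrite big_split /= -!mulr_sumr (@inverse_transform0 (fun j => c (j + N.-1)%N)).
  rewrite (@inverse_transform0 (fun j => c (j + 1)%N)).
- by rewrite !add0n /c autocorr_pred //; field.
- by move=> k; rewrite addnAC autocorr_cyclic.
- by move=> k; rewrite addnAC autocorr_cyclic.
Qed.

Let spectrum0 : p 0%N = (\sum_(k < N) F k) ^+ 2.
Proof.
rewrite /p /A /B; under eq_bigr => k _ do rewrite mul0r mulr0 cos0 mulr1.
under [X in _ + X ^+ 2]eq_bigr => k _ do rewrite mul0r mulr0 sin0 mulr0.
by rewrite big1_eq expr0n addr0.
Qed.

Let spectrum_pred : p N.-1 = p 1%N.
Proof.
have N1 : (0 < N)%N by rewrite (leq_trans _ N4).
have E k : k%:R * (N.-1%:R * al) = - (k%:R * (1 * al)) + k%:R * (2 * pi).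
  rewrite -Nal -subn1 natrB //; ring.
rewrite /p; congr (_ + _); last rewrite -[RHS]sqrrN -sumrN; congr (_ ^+ 2).
  by apply: eq_bigr => k _; rewrite E cos_per cosN.
by apply: eq_bigr => k _; rewrite E sin_per sinN mulrN.
Qed.

(** Discrete Wirtinger inequality with remainder.  In the spectrum the left side
    is the sum of the terms p m * (cos (m al) - cos al).  The mode 0 gives the
    square of the mean, the modes 1 and N - 1 cancel, and for every other mode
    the coefficient is at most cos (2 al) - cos al; by Parseval the total power
    of those modes is the last factor. *)
Lemma fourier_gap : 
  N%:R * (autocorr N F 1 - cos al * autocorr N F 0) <=
  (1 - cos al) * (\sum_(k < N) F k) ^+ 2 - (cos al - cos (2 * al)) *
   (N%:R * autocorr N F 0 - (\sum_(k < N) F k) ^+ 2 -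
     2 * ((\sum_(k < N) F k * cos (k%:R * al)) ^+ 2 +
          (\sum_(k < N) F k * sin (k%:R * al)) ^+ 2)).
Proof.
rewrite -/c -spectrum0.
have -> : (\sum_(k < N) F k * cos (k%:R * al)) ^+ 2 +
          (\sum_(k < N) F k * sin (k%:R * al)) ^+ 2 = p 1%N.
  by rewrite /p /A /B mul1r.
rewrite mulrBr mulrCA -sum_spectrum_cos -sum_spectrum.
have N1 : (0 < N)%N by rewrite (leq_trans _ N4).
have split3 (G : nat -> R) : \sum_(m < N) G m =
    G 0%N + G 1%N + \sum_(2 <= m < N.-1) G m + G N.-1.
  rewrite -(big_mkord xpredT G) -{1}(prednK N1) big_nat_recr //=; congr (_ + _).
  have N3 : (2 < N.-1)%N by rewrite -ltnS prednK.
  by rewrite big_ltn ?(leq_trans _ N3) // big_ltn ?(leq_trans _ N3) // addrA.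
rewrite (split3 (fun m => p m * cos (m%:R * al))) (split3 p) !spectrum_pred.
have -> : cos (N.-1%:R * al) = cos al.
  have -> : N.-1%:R * al = - al + 1%:R * (2 * pi).
    rewrite -Nal -subn1 natrB //; ring.
  by rewrite cos_per cosN.
rewrite mul0r cos0 mul1r.
have : \sum_(2 <= m < N.-1) p m * cos (m%:R * al) <=
       \sum_(2 <= m < N.-1) p m * cos (2 * al).
  apply: ler_sum_nat => m /andP[m2 mN]; apply: ler_wpM2l; first exact: p_ge0.
  have al0 : 0 < al by rewrite divr_gt0 ?ltr0n // mulr_gt0 ?pi_gt0.
  have angle_itv x : (x <= N)%N -> 0 <= x%:R * al / 2 <= pi.
    move=> xN; have x0 : 0 <= x%:R * al by apply: mulr_ge0 => //; exact: ltW.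
    rewrite divr_ge0 //=.
    by rewrite ler_pdivrMr // (mulrC pi) -Nal ler_pM2r // ler_nat.
  have mN2 : (m + 2 <= N)%N by move: mN; rewrite -{2}(prednK N1) addn2 ltnS.
  have : 0 <= sin ((m + 2)%:R * al / 2) * sin ((m - 2)%:R * al / 2).
    apply: mulr_ge0; apply: sin_ge0_pi; apply: angle_itv => //.
    by rewrite (leq_trans (leq_subr _ _)) // (leq_trans (leq_addr 2 m)).
  have -> : m%:R * al = (m + 2)%:R * al / 2 + (m - 2)%:R * al / 2.
    by rewrite natrD natrB //; field.
  have -> : 2 * al = (m + 2)%:R * al / 2 - (m - 2)%:R * al / 2.
    by rewrite natrD natrB //; field.
  rewrite cosB cosD; lra.
rewrite -mulr_suml; lra.
Qed.
End DFT.

(** The power outside the modes 0, 1 and N - 1 is the squared distance to their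
    span: on a grid of at least four points the functions 1, cos and sin are
    orthogonal, because the frequency 2 of their products is not a multiple
    of N. *)
Lemma fourier_residual (R : realType) (N : nat) (F : nat -> R) (N4 : (4 <= N)%N) :
  let al := 2 * pi / N%:R in
  let S := \sum_(k < N) F k in
  let a := \sum_(k < N) F k * cos (k%:R * al) in
  let b := \sum_(k < N) F k * sin (k%:R * al) in
  N%:R * autocorr N F 0 - S ^+ 2 - 2 * (a ^+ 2 + b ^+ 2) =
  N%:R * \sum_(k < N)
    (F k - (S + 2 * a * cos (k%:R * al) + 2 * b * sin (k%:R * al)) / N%:R) ^+ 2.
Proof.
move=> al S a b.
have N0 : N%:R != 0 :> R by rewrite pnatr_eq0 -lt0n (leq_trans _ N4).
have z1 : \sum_(k < N) cos (k%:R * al) = 0.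
  rewrite -[RHS](@sum_cos_eq0 R N 1 0); last by rewrite (leq_trans _ N4).
  by apply: eq_bigr => k _; rewrite mul1r add0r.
have z2 : \sum_(k < N) sin (k%:R * al) = 0.
  rewrite -[RHS](@sum_sin_eq0 R N 1 0); last by rewrite (leq_trans _ N4).
  by apply: eq_bigr => k _; rewrite mul1r add0r.
have z3 : \sum_(k < N) cos (k%:R * (2 * al)) = 0.
  rewrite -[RHS](@sum_cos_eq0 R N 2 0); last by rewrite (leq_trans _ N4).
  by apply: eq_bigr => k _; rewrite add0r.
have z4 : \sum_(k < N) sin (k%:R * (2 * al)) = 0.
  rewrite -[RHS](@sum_sin_eq0 R N 2 0); last by rewrite (leq_trans _ N4).
  by apply: eq_bigr => k _; rewrite add0r.
have dbl k : k%:R * (2 * al) = (k%:R * al) *+ 2 by rewrite mulr2n; ring.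
have E k : (F k - (S + 2 * a * cos (k%:R * al) + 2 * b * sin (k%:R * al)) / N%:R) ^+ 2 =
   F k * F (k + 0)%N - 2 / N%:R * (S * F k) - 2 / N%:R * (2 * a * (F k * cos (k%:R * al)))
   - 2 / N%:R * (2 * b * (F k * sin (k%:R * al)))
   + (S ^+ 2 + 2 * a ^+ 2 + 2 * b ^+ 2) / N%:R ^+ 2
   + (4 * a * S) / N%:R ^+ 2 * cos (k%:R * al) + (4 * b * S) / N%:R ^+ 2 * sin (k%:R * al)
   + (2 * a ^+ 2 - 2 * b ^+ 2) / N%:R ^+ 2 * cos (k%:R * (2 * al))
   + (4 * a * b) / N%:R ^+ 2 * sin (k%:R * (2 * al)).
  rewrite addn0 dbl sin_mulr2n cos_mulr2n.
  have := sin2cos2 (k%:R * al).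
  move: (cos _) (sin _) => x y yE.
  have -> : (F k - (S + 2 * a * x + 2 * b * y) / N%:R) ^+ 2 = 
    F k ^+ 2 - 2 / N%:R * F k * (S + 2 * a * x + 2 * b * y) +
    (S ^+ 2 + 4 * a ^+ 2 * x ^+ 2 + 4 * b ^+ 2 * y ^+ 2 + 4 * a * S * x
      + 4 * b * S * y + 8 * a * b * x * y) / N%:R ^+ 2 by field.
  by rewrite yE; field.
under eq_bigr => k _ do rewrite E.
rewrite !big_split /= !sumrN -!mulr_sumr z1 z2 z3 z4 !mulr0 !addr0.
rewrite -/S -/a -/b -/(autocorr N F 0) sumr_const card_ord -mulr_natl.
by field.
Qed.

(** * Heights and the Cauchy-Crofton bound *)

(** The terms have period M in k, so the phase may be shifted by multiples of the
    step until all the arguments lie in a half-turn where cos is nonnegative;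
    then the sum telescopes to a difference of two sines. *)
Lemma sum_abs_cos_le (R : realType) (M : nat) (x : R) : (0 < M)%N -> 0 <= x ->
  2 * sin (pi / M%:R / 2) * \sum_(k < M) `|cos (x + k%:R * (pi / M%:R))| <= 2.
Proof.
move=> M0 x0; set b := pi / M%:R.
have Mp : 0 < M%:R :> R by rewrite ltr0n.
have Mb : M%:R * b = pi by rewrite /b; field; rewrite gt_eqF.
have b0 : 0 < b by rewrite divr_gt0 ?pi_gt0.
pose y0 := x + pi / 2.
have y00 : 0 <= y0 by rewrite addr_ge0 // divr_ge0 ?pi_ge0.
(* the shift by j steps brings the phase into [- pi / 2, - pi / 2 + b[ *)
pose j := Num.truncn (y0 / b).
have := truncn_itv (divr_ge0 y00 (ltW b0)).
rewrite -/j => /andP[jl jr].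
have cM z : `|cos (z + M%:R * b)| = `|cos z| by rewrite Mb cosDpi normrN.
have shift i z : \sum_(k < M) `|cos (z + i%:R * b + k%:R * b)| =
                 \sum_(k < M) `|cos (z + k%:R * b)|.
  rewrite -[RHS](@cyclic_shift _ M (fun k => `|cos (z + k%:R * b)|) i).
    by apply: eq_bigr => k _; congr `|cos _|; rewrite natrD; ring.
  by move=> k; rewrite natrD mulrDl addrA cM.
pose z := x - j%:R * b.
have -> : \sum_(k < M) `|cos (x + k%:R * b)| = \sum_(k < M) `|cos (z + k%:R * b)|.
  by rewrite -(shift j z) /z; under [RHS]eq_bigr => k _ do rewrite subrK.
have zl : - (pi / 2) <= z.
  move: jl; rewrite ler_pdivlMr // /y0 /z; lra.
have zr : z < - (pi / 2) + b.
  move: jr; rewrite ltr_pdivrMr // /y0 /z -[j.+1%:R]natr1 (mulrDl j%:R) mul1r; lra.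
under eq_bigr => k _.
  rewrite ger0_norm; first over.
  apply: cos_ge0_pihalf; apply/andP; split.
    by rewrite (le_trans zl) // lerDl mulr_ge0 // ltW.
  have : (k.+1)%:R * b <= M%:R * b by rewrite ler_pM2r // ler_nat.
  rewrite -[k.+1%:R]natr1 mulrDl Mb; lra.
rewrite sum_cos_telescope.
have := sin_le1 (z + M%:R * b - b / 2); have := sin_geN1 (z - b / 2); lra.
Qed.

Section Directions.
Variable R : realType.
Implicit Types (p q : R * R) (th : R).

Definition enorm p : R := Num.sqrt (p.1 ^+ 2 + p.2 ^+ 2).
(** The scalar product with the unit vector of polar angle th. *)
Definition height th p : R := p.1 * cos th + p.2 * sin th.

Lemma enorm_ge0 p : 0 <= enorm p. Proof. exact: sqrtr_ge0. Qed.

Lemma sqr_enorm p : enorm p ^+ 2 = p.1 ^+ 2 + p.2 ^+ 2.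
Proof. by rewrite sqr_sqrtr // addr_ge0 ?sqr_ge0. Qed.

Lemma heightB th p q : height th (p - q) = height th p - height th q.
Proof. by rewrite /height /=; ring. Qed.

Lemma polar p : exists2 ph, 0 <= ph <= 2 * pi &
  p.1 = enorm p * cos ph /\ p.2 = enorm p * sin ph.
Proof.
have [n0|n0] := eqVneq (enorm p) 0.
  have := sqr_enorm p; rewrite n0 expr0n /= => /esym/eqP.
  rewrite paddr_eq0 ?sqr_ge0 // !sqrf_eq0 => /andP[/eqP-> /eqP->].
  by exists 0; rewrite ?lexx ?mulr_ge0 ?pi_ge0 // !mul0r.
have np : 0 < enorm p by rewrite lt_def n0 enorm_ge0.
pose x := p.1 / enorm p; pose y := p.2 / enorm p.
have xy : x ^+ 2 + y ^+ 2 = 1.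
  by rewrite /x /y !expr_div_n -mulrDl -sqr_enorm divff // expf_neq0.
have x1 : -1 <= x <= 1.
  rewrite -ler_norml -(@ler_pXn2r _ 2) ?nnegrE // expr1n real_normK ?num_real //.
  by rewrite -xy lerDl sqr_ge0.
have -> : p.1 = enorm p * x by rewrite /x; field.
have -> : p.2 = enorm p * y by rewrite /y; field.
have sy : Num.sqrt (1 - x ^+ 2) = `|y| by rewrite -sqrtr_sqr; congr Num.sqrt; lra.
have [y0|y0] := leP 0 y.
  exists (acos x).
    by rewrite acos_ge0 //= (le_trans (acos_lepi x1)) // mulr_natl mulr2n lerDl pi_ge0.
  by rewrite acosK ?in_itv //= sin_acos // sy ger0_norm.
exists (2 * pi - acos x).
  have := acos_ge0 x1; have := acos_lepi x1; lra.
have e : 2 * pi - acos x = - acos x + 1%:R * (2 * pi) by ring.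
by rewrite e cos_per sin_per cosN sinN acosK ?in_itv //= sin_acos // sy ltr0_norm // opprK.
Qed.

Lemma height_polar p : exists2 x, 0 <= x &
  forall th, height th p = enorm p * cos (x + th).
Proof.
have [ph /andP[ph0 ph1] [e1 e2]] := polar p; exists (2 * pi - ph); first lra.
move=> th; rewrite /height [in LHS]e1 [in LHS]e2.
have -> : 2 * pi - ph + th = th - ph + 1%:R * (2 * pi) by ring.
rewrite cos_per cosB; ring.
Qed.

(** Cauchy-Crofton for a segment: together, the projections on M equally spaced
    directions see at most 1 / sin (pi / (2 M)) times its length. *)
Lemma sum_abs_height_le (M : nat) p : (0 < M)%N ->
  sin (pi / M%:R / 2) * \sum_(k < M) `|height (k%:R * (pi / M%:R)) p| <= enorm p.
Proof.
move=> M0; have [x x0 xE] := height_polar p.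
under eq_bigr => k _ do rewrite xE normrM (ger0_norm (enorm_ge0 p)).
rewrite -mulr_sumr mulrCA ler_piMr ?enorm_ge0 //.
have := sum_abs_cos_le M0 x0; lra.
Qed.

End Directions.

(** * Invariance of the area *)

Section Plane.
Variable R : realType.
Local Notation mu := (@lebesgue_measure R).
Implicit Types (A U : set (R * R)).

Lemma open_contains_box (U : set (R * R)) p : open U -> U p -> exists2 e : R, 0 < e &
  forall q, `|q.1 - p.1| < e -> `|q.2 - p.2| < e -> U q.
Proof.
move=> oU Up; have /nbhs_ballP[e /= e0 be] : nbhs p U by exact: open_nbhs_nbhs.
exists e => // q h1 h2; apply: be; split; rewrite /ball /= distrC //.
Qed.

(** An open set is the union of the boxes with rational centre and rational
    half-side that it contains; they are countably many. *)
Lemma open_measurable_plane U : open U -> measurable U.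
Proof.
move=> oU.
pose box (t : rat * rat * rat) : set (R * R) :=
  `](ratr t.1.1 - ratr t.2 : R), ratr t.1.1 + ratr t.2[ `*`
  `](ratr t.1.2 - ratr t.2 : R), ratr t.1.2 + ratr t.2[.
pose F n : set (R * R) := if @unpickle (rat * rat * rat)%type n is Some t
  then (if `[< box t `<=` U >] then box t else set0) else set0.
rewrite (_ : U = \bigcup_n F n).
  apply: bigcup_measurable => n _; rewrite /F.
  case: unpickle => [t|]; last exact: measurable0.
  case: ifP => _; last exact: measurable0.
  by apply: measurableX; exact: measurable_itv.
apply/seteqP; split=> [p Up|p [n _]]; last first.
  by rewrite /F; case: unpickle => // t; case: ifPn => // /asboolP; apply.
have [e e0 be] := open_contains_box oU Up.
have [r] := @rat_in_itvoo R 0 (e / 2) (divr_gt0 e0 (ltr0Sn _ _)).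
rewrite in_itv /= => /andP[r0 re].
have close (x : R) : exists q : rat, `|ratr q - x| < ratr r.
  have [|q] := @rat_in_itvoo R (x - ratr r) (x + ratr r); first by lra.
  by rewrite in_itv /= -ltr_distl; exists q.
have [q1 h1] := close p.1; have [q2 h2] := close p.2.
have [n nE] : exists n, unpickle n = Some (q1, q2, r).
  by exists (pickle (q1, q2, r)); exact: pickleK.
exists n; first exact: I.
rewrite /F nE.
move: h1 h2; rewrite !ltr_distl => /andP[h1 h1'] /andP[h2 h2'].
have -> : `[< box (q1, q2, r) `<=` U >].
  apply/asboolP => z [/=]; rewrite !in_itv /= => /andP[z1 z1'] /andP[z2 z2'].
  by apply: be; rewrite ltr_distl; lra.
by split; rewrite /= in_itv /=; lra.
Qed.

Lemma lebesgue_translation (c : R) (A : set R) : measurable A ->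
  mu [set y | A (y + c)] = mu A.
Proof.
move=> mA; suff : pushforward mu ((fun y => y + c) : _ -> measurableTypeR R) A = mu A by [].
apply/esym/lebesgue_measure_unique => //=.
  by apply: measurable_funD => //; exact: measurable_id. 
move=> ? _ [[a b]] _ <-; rewrite /pushforward.
rewrite (_ : _ @^-1` _ = `]a - c, b - c]%classic).
  rewrite !lebesgue_measure_itv/= !lte_fin ltrD2r; case: ifP => // _.
  by rewrite -!EFinB; congr EFin; ring.
by apply/seteqP; split => y /=; rewrite !in_itv /=; lra.
Qed.

Definition area_preserving (f : R * R -> R * R) := forall A, measurable A ->
  measurable (f @^-1` A) /\ area (f @^-1` A) = area A.

Lemma preserving_comp f g : area_preserving f -> area_preserving g -> area_preserving (g \o f).
Proof.
move=> pf pg A mA; have [mg <-] := pg A mA; have [mf <-] := pf _ mg.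
by [].
Qed.

Lemma preserving_ext f g : area_preserving f -> f =1 g -> area_preserving g.
Proof. by move=> pf /funext <-. Qed.

(** Every vertical section is translated, so that Fubini reduces the claim to
    the invariance of the Lebesgue measure of the line. *)
Lemma vshear_preserving (phi : R -> R) : measurable_fun setT phi ->
  area_preserving (fun p => (p.1, p.2 + phi p.1)).
Proof.
move=> mphi A mA; split.
  rewrite -[X in measurable X]setTI.
  suff : measurable_fun setT (fun p : R * R => (p.1, p.2 + phi p.1)) by exact.
  apply: measurable_fun_pair; first exact: measurable_fst.
  apply: measurable_funD; first exact: measurable_snd.
  exact: measurableT_comp measurable_fst.
apply: eq_integral => x _ /=.
rewrite -(lebesgue_translation (phi x) (measurable_xsection x mA)).
congr (mu _); apply/seteqP; split => y /=; rewrite /xsection /= !inE //.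
Qed.

Definition swap (p : R * R) := (p.2, p.1).

Lemma measurable_swap : measurable_fun setT swap.
Proof. by apply: measurable_fun_pair; [exact: measurable_snd|exact: measurable_fst]. Qed.

(** This is the exchange of the order of integration. *)
Lemma swap_preserving : area_preserving swap.
Proof.
move=> A mA; split.
  by rewrite -[X in measurable X]setTI; exact: measurable_swap.
have := @indic_fubini_tonelli _ _ _ _ R mu mu A mA.
by rewrite indic_fubini_tonelli_FE // indic_fubini_tonelli_GE.
Qed.

Lemma hshear_preserving (phi : R -> R) : measurable_fun setT phi ->
  area_preserving (fun p => (p.1 + phi p.2, p.2)).
Proof.
move=> mphi.
exact: (preserving_comp swap_preserving (preserving_comp (vshear_preserving mphi) swap_preserving)).
Qed.

(** A rotation with s != 0 is the product of three shears, of slopes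
    (1 - c) / s, - s and (1 - c) / s; the half-turn, where s = 0, is the square
    of a quarter-turn. *)
Lemma rotation_preserving (c s : R) : c ^+ 2 + s ^+ 2 = 1 ->
  area_preserving (fun p => (c * p.1 + s * p.2, c * p.2 - s * p.1)).
Proof.
have mM (k : R) : measurable_fun [set: R] (fun x => k * x).
  by apply: measurable_funM => //; exact: measurable_id.
have shears (x y : R) : x ^+ 2 + y ^+ 2 = 1 -> y != 0 ->
    area_preserving (fun p => (x * p.1 + y * p.2, x * p.2 - y * p.1)).
  move=> xy y0; pose k := (1 - x) / y.
  have H := preserving_comp (hshear_preserving (mM k))
    (preserving_comp (vshear_preserving (mM (- y))) (hshear_preserving (mM k))).
  apply: preserving_ext H _ => -[p q] /=; congr pair; last by rewrite /k; field.
  have -> : y * q = (1 - x ^+ 2) / y * q by rewrite -xy addrAC subrr add0r; field.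
  by rewrite /k; field.
move=> cs; have [s0|] := eqVneq s 0; last exact: shears.
move: cs; rewrite s0 expr0n addr0 => /eqP; rewrite sqrf_eq1 => /orP[] /eqP ->.
  apply: (@preserving_ext id) => // -[x y] /=; congr pair; ring.
have q : area_preserving (fun p => (0 * p.1 + 1 * p.2, 0 * p.2 - 1 * p.1)).
  by apply: shears; rewrite ?oner_neq0 // expr0n expr1n add0r.
by apply: preserving_ext (preserving_comp q q) _ => -[x y] /=; congr pair; ring.
Qed.

Lemma translation_preserving (o : R * R) : area_preserving (fun p => (p.1 - o.1, p.2 - o.2)).
Proof.
exact: (preserving_comp (@vshear_preserving (cst (- o.2)) (measurable_cst _))
                        (@hshear_preserving (cst (- o.1)) (measurable_cst _))).
Qed.

(** A triangle with one vertex at the origin and the opposite side on the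
    vertical line of abscissa h. *)
Definition wedge (l r h : R) : set (R * R) :=
  [set p | [/\ 0 <= p.1, p.1 <= h, - (l * p.1) <= p.2 & p.2 <= r * p.1]].

Lemma measurable_le_set (f g : R * R -> R) : measurable_fun setT f ->
  measurable_fun setT g -> measurable [set p | f p <= g p].
Proof.
move=> mf mg; rewrite -[X in measurable X]setTI.
have mle := measurable_fun_ler mf mg.
exact: (mle measurableT [set true]).
Qed.

Lemma wedge_measurable (l r h : R) : measurable (wedge l r h).
Proof.
have m1 : measurable_fun [set: R * R] fst by exact: measurable_fst.
have m2 : measurable_fun [set: R * R] snd by exact: measurable_snd.
have mk (k : R) : measurable_fun setT (fun p : R * R => k * p.1).
  by apply: measurable_funM => //; exact: measurable_cst.
have mc (k : R) : measurable_fun setT (fun p : R * R => k) by exact: measurable_cst.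
rewrite (_ : wedge l r h = [set p | 0 <= p.1] `&` [set p | p.1 <= h] `&`
   [set p | - l * p.1 <= p.2] `&` [set p | p.2 <= r * p.1]).
  by repeat apply: measurableI; exact: measurable_le_set.
apply/seteqP; split => p /=; rewrite /wedge /= mulNr; first by case.
by move=> [[[]]].
Qed.

Lemma area_wedge (l r h : R) : 0 <= l + r -> 0 < h ->
  area (wedge l r h) = ((l + r) * h ^+ 2 / 2)%:E.
Proof.
move=> lr h0; rewrite /area /product_measure1.
transitivity (\int[mu]_(x in `[0%R, h]) ((l + r) * x)%:E)%E.
  rewrite [RHS]integral_mkcond; apply: eq_integral => x _ /=.
  rewrite patchE; case: ifPn => [|xn].
    rewrite inE /= ?in_itv /= => /andP[x0 xh].
    rewrite (_ : xsection _ _ = `[- (l * x), r * x]%classic).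
      rewrite lebesgue_measure_itv /= lte_fin; case: ifPn => [_|].
        by rewrite -EFinB; congr EFin; ring.
      rewrite -leNgt => H; congr EFin.
      have : 0 <= (l + r) * x by rewrite mulr_ge0.
      lra.
    apply/seteqP; split => y; rewrite /xsection /= !inE /wedge /= ?in_itv /=.
      by move=> [_ _ h1 h2]; apply/andP.
    by move=> /andP[].
  rewrite (_ : xsection _ _ = set0) ?measure0 //.
  rewrite -subset0 => y; rewrite /xsection /= ?inE /wedge /= => -[x0 xh _ _].
  by move: xn; rewrite notin_setE /= ?in_itv /= x0 xh.
rewrite (@continuous_FTC2 _ _ (fun x : R => (l + r) * x ^+ 2 / 2) _ _ h0).
- by rewrite -EFinB; congr EFin; rewrite expr0n /= mulr0 mul0r subr0.
- by apply: continuous_subspaceT => x; apply: mulrl_continuous.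
- have D (x : R) : is_derive x 1 (fun x : R => (l + r) * x ^+ 2 / 2) ((l + r) * x).
    by apply: is_derive_eq; rewrite /GRing.scale /=; field.
  have C : continuous (fun x : R => (l + r) * x ^+ 2 / 2).
    by move=> x; apply: differentiable_continuous; apply/derivable1_diffP.
  split; first by move=> x _; exact: (@ex_derive _ _ _ _ _ _ _ (D x)).
    by apply: cvg_at_right_filter; exact: C.
  by apply: cvg_at_left_filter; exact: C.
- move=> x _; rewrite derive1E.
  suff : is_derive x 1 (fun x : R => (l + r) * x ^+ 2 / 2) ((l + r) * x).
    by move=> H; rewrite derive_val.
  by apply: is_derive_eq; rewrite /GRing.scale /=; field.
Qed.

End Plane.

(** * The area of a circumscribed polygon *)

Lemma cyclic_mod (T : Type) N (F : nat -> T) j : cyclic N F -> F j = F (j %% N)%N.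
Proof.
move=> cF; rewrite {1}(divn_eq j N) addnC; elim: (_ %/ _)%N => [|m IH].
  by rewrite mul0n addn0.
by rewrite mulSn (addnC N) addnA cF.
Qed.

Lemma heightD (R : realType) (th x : R) (p : R * R) :
  height (th + x) p = cos x * height th p + sin x * (cos th * p.2 - sin th * p.1).
Proof. by rewrite /height cosD sinD; ring. Qed.

Lemma le_area (R : realType) (A B : set (R * R)) :
  measurable A -> measurable B -> A `<=` B -> (area A <= area B)%E.
Proof. by move=> mA mB AB; rewrite /area; apply: le_measure; rewrite ?inE. Qed.

Lemma area_bigU_le (R : realType) (T : nat -> set (R * R)) n :
  (forall k, measurable (T k)) ->
  (area (\big[setU/set0]_(k < n) T k) <= \sum_(k < n) area (T k))%E.
Proof.
move=> mT; rewrite /area.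
have := @Boole_inequality _ _ _ (@lebesgue_measure R \x @lebesgue_measure R)%E T n.
by apply => k _; exact: mT.
Qed.

(** The polygon with support numbers F k splits into the triangles that join o
    to its sides.  In the frame of the k-th normal such a triangle is a wedge of
    height F k, and its slopes l k and r k come from the intersection with the two
    adjacent support lines; the condition on three consecutive support numbers
    says that the side has nonnegative length.  A point belongs to the triangle
    of the direction in which the ratio of its height to F is the largest: the
    comparison with the adjacent directions gives the two slanted sides of the
    wedge, and the comparison with the opposite direction shows that the height
    is nonnegative. *)
Lemma area_polygon_le (R : realType) (M : nat) (F : nat -> R) (o : R * R)
    (E : set (R * R)) (N := (2 * M)%N) (al : R := 2 * pi / N%:R) :
  (1 < M)%N -> cyclic N F -> (forall k, 0 < F k) ->
  (forall k, 2 * cos al * F k.+1 <= F k + F k.+2) ->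
  measurable E ->
  (forall p, E p -> forall k, height (k%:R * al) (p - o) <= F k) ->
  (area E <= ((autocorr N F 1 - cos al * autocorr N F 0) / sin al)%:E)%E.
Proof.
move=> M1 cF F0 Fconv mE EF.
have N0 : (0 < N)%N by rewrite /N; lia.
have Np : 0 < N%:R :> R by rewrite ltr0n.
have Nal : N%:R * al = 2 * pi by rewrite /al; field; rewrite gt_eqF.
have Mal : M%:R * al = pi.
  by move: Nal; rewrite /N natrM; lra.
have al0 : 0 < al by rewrite divr_gt0 ?mulr_gt0 ?pi_gt0.
have sal : 0 < sin al.
  apply: sin_gt0_pi; rewrite al0 -Mal ltr_pMl //= ltr1n //.
have F1 k : F k != 0 by rewrite gt_eqF.
pose l k := (F (k + N.-1)%N - F k * cos al) / (F k * sin al).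
pose r k := (F k.+1 - F k * cos al) / (F k * sin al).
pose rho k (p : R * R) : R * R := let v := p - o in
  (cos (k%:R * al) * v.1 + sin (k%:R * al) * v.2,
   cos (k%:R * al) * v.2 - sin (k%:R * al) * v.1).
have rhoP k : area_preserving (rho k).
  exact: (preserving_comp (translation_preserving o)
            (rotation_preserving (cos2Dsin2 (k%:R * al)))).
pose T k := rho k @^-1` wedge (l k) (r k) (F k).
have mT k : measurable (T k) by case: (rhoP k _ (wedge_measurable (l k) (r k) (F k))).
have aT k : area (T k) =
    ((F k * F (k + N.-1)%N + F k * F k.+1 - 2 * cos al * (F k * F k)) / (2 * sin al))%:E.
  have [_ ->] := rhoP k _ (wedge_measurable (l k) (r k) (F k)).
  rewrite area_wedge //.
    by congr EFin; rewrite /l /r; field; rewrite F1 gt_eqF.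
  rewrite /l /r -mulrDl divr_ge0 //; last by rewrite mulr_ge0 ?ltW.
  have := Fconv (k + N.-1)%N.
  have -> : (k + N.-1).+1 = (k + N)%N by rewrite -addnS prednK.
  rewrite -addSn.
  rewrite !cF; lra.
have cover : E `<=` \big[setU/set0]_(k < N) T k.
  move=> p Ep; have Hp := EF p Ep.
  pose x k := height (k%:R * al) (p - o).
  have cx : cyclic N x.
    move=> k; have e : (k + N)%:R * al = k%:R * al + 1%:R * (2 * pi).
      by rewrite mul1r -Nal natrD mulrDl.
    by rewrite /x /height e cos_per sin_per.
  pose G k := x k / F k.
  have cG : cyclic N G by move=> k; rewrite /G cx cF.
  have [k _ kmax] := @arg_maxP _ _ _ (Ordinal N0) xpredT (fun i : 'I_N => G i) isT.
  have {}kmax j : G j <= G k.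
    rewrite (cyclic_mod _ cG).
    exact: (kmax (Ordinal (ltn_pmod j N0)) isT).
  have Gle j : x j * F k <= x k * F j.
    by have := kmax j; rewrite /G ler_pdivrMr // mulrAC ler_pdivlMr.
  rewrite -bigcup_mkord; exists (val k); first exact: ltn_ord.
  set s := x k; set t := cos (k%:R * al) * (p - o).2 - sin (k%:R * al) * (p - o).1.
  have xn : x k.+1 = s * cos al + t * sin al.
    by rewrite /x -natr1 mulrDl mul1r heightD mulrC [X in _ + X]mulrC.
  have xp : x (k + N.-1)%N = s * cos al - t * sin al.
    rewrite /x; have -> : (k + N.-1)%:R * al = k%:R * al - al + 1%:R * (2 * pi).
      by rewrite mul1r -Nal natrD -subn1 natrB //; ring.
    by rewrite /height cos_per sin_per -/(height _ _) heightD cosN sinN /s /x /t; ring.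
  have xM : x (k + M)%N = - s.
    by rewrite /x natrD mulrDl Mal /height cosDpi sinDpi /s /x /height; ring.
  (* the direction opposite to k is k + M; it has height - s *)
  have s0 : 0 <= s.
    have := Gle (k + M)%N; rewrite xM -/s => H.
    have : 0 <= s * (F k + F (k + M)%N) by lra.
    by rewrite pmulr_lge0 // addr_gt0.
  have sE : cos (k%:R * al) * (p - o).1 + sin (k%:R * al) * (p - o).2 = s.
    by rewrite /s /x /height; ring.
  suff [h1 h2 h3] : [/\ s <= F k, - (l k * s) <= t & t <= r k * s].
    by split; rewrite /rho ?sE.
  split; first exact: Hp.
  - have := Gle (k + N.-1)%N; rewrite xp -/s => H.
    have FS : 0 < F k * sin al by rewrite mulr_gt0.
    rewrite -/t lerNl /l mulrAC ler_pdivlMr //; lra.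
  - have := Gle k.+1; rewrite xn -/s => H.
    have FS : 0 < F k * sin al by rewrite mulr_gt0.
    rewrite -/t /r mulrAC ler_pdivlMr //; lra.
apply: (@le_trans _ _ (\sum_(k < N) area (T k))%E).
  apply: le_trans (area_bigU_le _ mT); apply: le_area => //.
  by apply: bigsetU_measurable => k _; exact: mT.
under eq_bigr => k _ do rewrite aT.
rewrite sumEFin lee_fin -mulr_suml !big_split /= sumrN -mulr_sumr.
rewrite -/(autocorr N F N.-1) autocorr_pred //.
have -> : \sum_(k < N) F k * F k.+1 = autocorr N F 1.
  by apply: eq_bigr => k _; rewrite addn1.
have -> : \sum_(k < N) F k * F k = autocorr N F 0.
  by apply: eq_bigr => k _; rewrite addn0.
rewrite le_eqVlt; apply/orP; left; apply/eqP; field.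
by rewrite gt_eqF.
Qed.

(** * The enclosed region *)

Section PlaneTopology.
Variable R : realType.
Implicit Types (p q : R * R) (th : R).

Lemma fst_continuous : continuous (@fst R R).
Proof. by move=> p; exact: cvg_fst. Qed.

Lemma snd_continuous : continuous (@snd R R).
Proof. by move=> p; exact: cvg_snd. Qed.

Lemma height_continuous th : continuous (@height R th).
Proof.
move=> p; rewrite /height.
apply: cvgD; apply: cvgM; try exact: cvg_cst.
  exact: fst_continuous.
exact: snd_continuous.
Qed.

Lemma line_continuous p q : continuous (fun t : R => (p.1 + t * q.1, p.2 + t * q.2)).
Proof.
have C (x y : R) : continuous (fun t : R => x + t * y).
  move=> t; apply: cvgD; first exact: cvg_cst.
  by apply: cvgM; [exact: cvg_id|exact: cvg_cst].
move=> t.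
exact: (@cvg_pair _ _ _ (nbhs t) (nbhs (p.1 + t * q.1)) (nbhs (p.2 + t * q.2))
  _ _ _ _ _ (C p.1 q.1 t) (C p.2 q.2 t)).
Qed.

Lemma segment_joins (A : set (R * R)) p q : 
  (forall t, 0 <= t <= 1 -> A (p.1 + t * q.1, p.2 + t * q.2)) ->
  connected_component A p (p.1 + q.1, p.2 + q.2).
Proof.
move=> pqA; pose g t := (p.1 + t * q.1, p.2 + t * q.2).
have gA : g @` `[0%R, 1%R] `<=` A.
  by move=> _ [t + <-] /=; rewrite ?in_itv /= => /pqA.
have cg : connected (g @` `[0%R, 1%R]).
  apply: connected_continuous_connected; first exact: segment_connected.
  by apply: continuous_subspaceT; exact: line_continuous.
have gp : (g @` `[0%R, 1%R]) p.
  exists 0; first by rewrite /= ?in_itv /= lexx ler01.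
  by rewrite /g !mul0r !addr0 -surjective_pairing.
apply: (connected_component_max gp gA cg).
by exists 1; rewrite /= ?in_itv /= ?lexx ?ler01 // /g !mul1r.
Qed.

Lemma bounded_setP (A : set (R * R)) : bounded_set A ->
  exists M, forall p, A p -> `|p.1| <= M /\ `|p.2| <= M.
Proof.
move=> [M [_ MA]]; exists (M + 1) => p Ap.
have M1 : M < M + 1 by rewrite ltrDl.
have := MA (M + 1) M1 p Ap.
by rewrite /Num.norm /= ge_max => /andP[].
Qed.

End PlaneTopology.

Section Curve.
Variables (R : realType) (a b : R) (gamma : R -> R * R).
Hypothesis ab : a < b.
Hypothesis cg : {within `[a, b], continuous gamma}.
Let image := curve_image a b gamma.
Let E := enclosed_region a b gamma.

Lemma curve_image_compact : compact image.
Proof. by apply: continuous_compact => //; exact: segment_compact. Qed.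

Lemma curve_image_closed : closed image.
Proof. by apply: compact_closed; [exact: norm_hausdorff|exact: curve_image_compact]. Qed.

(** A small box around a point avoids the image, which is compact, and segments
    join the point to the rest of the box inside the same component. *)
Lemma enclosed_open : open E.
Proof.
rewrite openE => p [Cp bp].
have oC : open (~` image) by apply: closed_openC; exact: curve_image_closed.
have [e e0 be] := open_contains_box oC Cp.
apply/nbhs_ballP; exists e => // q [q1 q2].
have Cq : (~` image) q by apply: be; rewrite distrC.
split => //.
have -> // : connected_component (~` image) q = connected_component (~` image) p.
apply/esym/same_connected_component.
have -> : q = (p.1 + (q - p).1, p.2 + (q - p).2) by case: q {q1 q2 Cq} => x y /=; congr pair; ring.
apply: segment_joins => t /andP[t0 t1]; apply: be => /=; rewrite addrAC subrr add0r.
  rewrite normrM ger0_norm // (le_lt_trans (ler_piMl _ t1)) //.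
  by rewrite distrC.
rewrite normrM ger0_norm // (le_lt_trans (ler_piMl _ t1)) //.
by rewrite distrC.
Qed.

(** A point that is higher than the whole curve starts a ray that avoids it;
    the component of the point would then be unbounded. *)
Lemma enclosed_height th h p : 
  (forall t, a <= t <= b -> height th (gamma t) <= h) -> E p -> height th p <= h.
Proof.
move=> gh [Cp bp]; rewrite leNgt; apply/negP => hp.
have [M HM] := bounded_setP bp.
(* coordinates bounded by M give a height of at most 2 M, so a segment of length
   s leaves the component *)
pose s := M + M + `|height th p| + 1.
have M0 : 0 <= M.
  have [|H _] := HM p; last exact: le_trans (normr_ge0 _) H.
  by apply: connected_component_refl.
have s0 : 0 <= s by rewrite /s !addr_ge0.
have hline t : height th (p.1 + t * (s * cos th), p.2 + t * (s * sin th)) =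
    height th p + t * s.
  rewrite /height /= mulrDl (mulrDl p.2); rewrite addrACA; congr (_ + _).
  rewrite -[RHS]mulr1 -(cos2Dsin2 th); ring.
pose q : R * R := (s * cos th, s * sin th).
have Cq : connected_component (~` image) p (p.1 + q.1, p.2 + q.2).
  apply: segment_joins => t /andP[t0 t1] [u + ug].
  rewrite /= ?in_itv /= => /gh; rewrite ug hline; apply/negP; rewrite -ltNge.
  by rewrite (lt_le_trans hp) // lerDl mulr_ge0.
have [h1 h2] := HM _ Cq.
have : height th (p.1 + q.1, p.2 + q.2) = height th p + s.
  by have := hline 1; rewrite !mul1r.
have : height th (p.1 + q.1, p.2 + q.2) <= M + M.
  have bnd x y : `|x| <= M -> `|y| <= 1 -> x * y <= M.
    move=> xM y1; rewrite (le_trans (ler_norm _)) // normrM.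
    by rewrite -[M]mulr1 ler_pM.
  by rewrite /height lerD // bnd // ?cos_max ?sin_max.
have := ler_norm (- height th p); rewrite normrN /s; lra.
Qed.

(** Attainment of the maximum matters: the times where it is attained become
    vertices of the polygons inscribed in the curve. *)
Lemma support_function (o : R * R) : exists f : R -> R,
  (forall th t, a <= t <= b -> height th (gamma t - o) <= f th) /\
  (forall th, exists2 t, a <= t <= b & height th (gamma t - o) = f th).
Proof.
have ex th : exists y, (forall t, a <= t <= b -> height th (gamma t - o) <= y) /\
    (exists2 t, a <= t <= b & height th (gamma t - o) = y).
  have cf : {within `[a, b], continuous (height th \o gamma)}.
    move=> t; apply: (@continuous_comp (subspace `[a, b]) _ _ gamma (height th)).
      exact: cg.
    exact: height_continuous.
  have [c cab cmax] := EVT_max (ltW ab) cf.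
  exists (height th (gamma c - o)); split; last by exists c => //; move: cab; rewrite in_itv.
  by move=> t tab; rewrite !heightB lerD2r; apply: cmax; rewrite in_itv.
have [f fP] := choice ex.
by exists f; split => th; have [] := fP th.
Qed.

End Curve.

(** * Inscribed polygons and length *)

Section Partitions.
Variable R : realType.

Lemma path_insert (s : seq R) (a t : R) : path <%R a s -> a <= t <= last a s ->
  exists s', [/\ path <%R a s', last a s' = last a s &
                 {subset t :: a :: s <= a :: s'}].
Proof.
elim: s a => [|x s IH] a /=.
  move=> _ tE; have -> : t = a by apply/eqP; rewrite eq_le andbC.
  by exists [::]; split => // y; rewrite !inE orbb.
move=> /andP[ax ps] /andP[at_ tl].
have [tx|xt] := ltP t x; last first.
  have [|s' [ps' ls' sub]] := IH x ps; first by rewrite xt.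
  exists (x :: s'); split; rewrite /= ?ax //.
  move=> y; rewrite !inE => yE; have := sub y; rewrite !inE.
  case/or3P: yE => [->|->|->] H; rewrite ?orbT //; try by rewrite H ?orbT.
have [ta|ta] := eqVneq t a.
  exists (x :: s); split; rewrite /= ?ax ?ta //.
  by move=> y; rewrite !inE => /orP[->|].
exists (t :: x :: s); split => //=; first by rewrite tx ps lt_def ta at_.
by move=> y; rewrite !inE => /or4P[->|->|->|->]; rewrite ?orbT.
Qed.

Lemma partition_through (a b : R) (ts : seq R) : a < b ->
  {in ts, forall t, a <= t <= b} ->
  exists2 s, itv_partition a b s & {subset ts <= a :: s}.
Proof.
move=> ab; elim: ts => [|t ts IH] tab.
  by exists [:: b] => //; split; rewrite /= ?ab.
have [|s [ps /eqP ls] sub] := IH.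
  by move=> u ut; apply: tab; rewrite inE ut orbT.
have [|s' [ps' ls' sub']] := path_insert (t := t) ps.
  by rewrite ls; apply: tab; rewrite inE eqxx.
exists s'; first by split => //; rewrite ls' ls.
move=> u; rewrite inE => /orP[/eqP ->|/sub H]; apply: sub'; rewrite inE ?eqxx //.
by rewrite H orbT.
Qed.

Lemma abs_telescope (g : nat -> R) i j : (i <= j)%N ->
  `|g j - g i| <= \sum_(i <= m < j) `|g m.+1 - g m|.
Proof. by move=> ij; rewrite -telescope_sumr //; exact: ler_norm_sum. Qed.

(** A closed walk crosses the gap between any two of its positions twice. *)
(** A closed walk crosses the gap between any two of its positions twice. *)
Lemma closed_variation (g : nat -> R) n i j : (i <= n)%N -> (j <= n)%N ->
  g 0%N = g n -> 2 * `|g i - g j| <= \sum_(0 <= m < n) `|g m.+1 - g m|.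
Proof.
wlog ij : i j / (i <= j)%N => [H iN jN|iN jN gn].
  by have [ij|/ltnW ji] := leqP i j; [exact: H|rewrite distrC; exact: H].
rewrite (big_cat_nat (n := i)) //= (big_cat_nat (m := i) (n := j)) //=.
have h1 := abs_telescope g (leq0n i); have h2 := abs_telescope g ij.
have h3 := abs_telescope g jN.
have := ler_normB (g i - g 0%N) (g j - g n).
rewrite gn (_ : _ - _ - _ = g i - g j); last by ring.
rewrite (distrC (g i) (g j)) in h2 * => h4.
rewrite gn in h1; rewrite (distrC (g j) (g n)) in h4.
by rewrite mulr2n mulrDl !mul1r; lra.
Qed.

End Partitions.

Section CurveLength.
Variables (R : realType) (a b : R) (gamma : R -> R * R) (L : R).
Hypothesis ab : a < b.
Hypothesis closed_gamma : gamma a = gamma b.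
Hypothesis hL : curve_length a b gamma = L%:E.

Lemma polygon_length_le s : itv_partition a b s -> polygon_length a b gamma s <= L.
Proof.
by move=> ps; rewrite -lee_fin -hL; apply: ereal_sup_ubound; exists s.
Qed.

Lemma polygon_width s th t u : itv_partition a b s ->
  t \in a :: s -> u \in a :: s ->
  2 * `|height th (gamma t) - height th (gamma u)| <=
  \sum_(0 <= m < size s) `|height th
     (gamma (nth b (a :: s) m.+1) - gamma (nth b (a :: s) m))|.
Proof.
move=> [_ /eqP ls] ts us.
pose g m := height th (gamma (nth b (a :: s) m)).
have lb : nth b (a :: s) (size s) = b by rewrite -[RHS]ls -(last_nth b a s).
have it : (index t (a :: s) <= size s)%N by rewrite -ltnS -[(size s).+1]/(size (a :: s)) index_mem.
have iu : (index u (a :: s) <= size s)%N by rewrite -ltnS -[(size s).+1]/(size (a :: s)) index_mem.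
have := @closed_variation _ g _ _ _ it iu.
rewrite /g !nth_index // lb [nth b (a :: s) 0]/= closed_gamma => /(_ erefl) h.
apply: le_trans h _; apply: ler_sum => m _; by rewrite heightB.
Qed.

(** Cauchy-Crofton for the curve.  Take an inscribed polygon through all the
    points where the curve is extremal in a direction of the grid.  Its
    variation in each direction is at least twice the width, and the widths are
    the sums of f over opposite directions.  Summed over the directions, the
    variations of a single edge are controlled by the length of that edge. *)
Lemma curve_perimeter (o : R * R) (f : R -> R) M (be := pi / M%:R) : (0 < M)%N ->
  (forall th, exists2 t, a <= t <= b & height th (gamma t - o) = f th) ->
  2 * sin (be / 2) * \sum_(k < 2 * M) f (k%:R * be) <= L.
Proof.
move=> M0 fP.
have {}fP th : exists t, a <= t <= b /\ height th (gamma t - o) = f th.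
  by have [t] := fP th; exists t.
have [T TP] := choice fP.
have [|s ps sub] := @partition_through _ a b [seq T (k%:R * be) | k <- iota 0 (2 * M)] ab.
  by move=> t /mapP[k _ ->]; case: (TP (k%:R * be)).
have inS k : (k < 2 * M)%N -> T (k%:R * be) \in a :: s.
  by move=> kM; apply: sub; apply: map_f; rewrite mem_iota.
apply: le_trans (polygon_length_le ps).
have Mbe : M%:R * be = pi by rewrite /be; field; rewrite pnatr_eq0 -lt0n.
pose D m := gamma (nth b (a :: s) m.+1) - gamma (nth b (a :: s) m).
have width k : (k < M)%N -> 2 * (f (k%:R * be) + f ((M + k)%:R * be)) <=
    \sum_(0 <= m < size s) `|height (k%:R * be) (D m)|.
  move=> kM; have k1 : (k < 2 * M)%N by lia.
  have k2 : (M + k < 2 * M)%N by lia.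
  apply: le_trans (polygon_width _ ps (inS _ k1) (inS _ k2)).
  have [_ <-] := TP (k%:R * be); have [_ <-] := TP ((M + k)%:R * be).
  have -> v : height ((M + k)%:R * be) v = - height (k%:R * be) v.
    by rewrite natrD mulrDl Mbe addrC /height cosDpi sinDpi; ring.
  rewrite !heightB; set x := height _ _; set y := height _ _; set z := height _ _.
  have := ler_norm (x - z); lra.
rewrite mul2n -addnn big_split_ord /= -big_split /=.
rewrite (mulrC 2) -mulrA mulr_sumr.
have sb : 0 <= sin (be / 2).
  apply: sin_ge0_pi; rewrite divr_ge0 ?divr_ge0 ?pi_ge0 //=.
  rewrite ler_pdivrMr // ler_pdivrMr ?ltr0n // -mulrA ler_peMr ?pi_ge0 //.
  by rewrite -natrM ler1n muln_gt0.
apply: (@le_trans _ _ (sin (be / 2) * \sum_(k < M)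
    \sum_(0 <= m < size s) `|height (k%:R * be) (D m)|)).
  by apply: ler_wpM2l => //; apply: ler_sum => k _; exact: width.
rewrite exchange_big /= mulr_sumr /polygon_length; apply: ler_sum => m _.
exact: sum_abs_height_le.
Qed.

End CurveLength.

Lemma le_of_quadratic (R : realType) (x y p q : R) : 0 <= p -> 0 <= q ->
  (forall e, 0 < e -> x <= y + p * e + q * e ^+ 2) -> x <= y.
Proof.
move=> p0 q0 H; rewrite leNgt; apply/negP => yx.
have pq : 0 < p + q + 1 by lra.
pose d := (x - y) / (p + q + 1); pose e := Num.min 1 (d / 2).
have d0 : 0 < d by rewrite divr_gt0 // subr_gt0.
have e0 : 0 < e by rewrite lt_min ltr01 divr_gt0.
have e1 : e <= 1 by rewrite ge_min lexx.
have ed : e <= d / 2 by rewrite ge_min lexx orbT.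
have xd : x - y = d * (p + q + 1) by rewrite /d; field; rewrite gt_eqF.
have := H e e0.
have : q * e ^+ 2 <= q * e by rewrite ler_wpM2l // expr2 ler_piMr // ltW.
have : (p + q) * e <= (p + q) * (d / 2) by rewrite ler_wpM2l // addr_ge0.
have : 0 <= (p + q) * d by rewrite mulr_ge0 ?addr_ge0 ?(ltW d0).
lra.
Qed.

(** * The inequality on a grid of directions *)

Lemma autocorr_addc (R : realType) N (F : nat -> R) e j : cyclic N F ->
  autocorr N (fun k => F k + e) j =
  autocorr N F j + 2 * e * \sum_(k < N) F k + N%:R * e ^+ 2.
Proof.
move=> cF; rewrite /autocorr.
have -> : 2 * e * \sum_(k < N) F k =
  e * \sum_(k < N) F k + e * \sum_(k < N) F (k + j)%N by rewrite cyclic_shift //; ring.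
have -> : N%:R * e ^+ 2 = \sum_(k < N) e ^+ 2 by rewrite sumr_const card_ord mulr_natl.
rewrite !mulr_sumr -!big_split /=; apply: eq_bigr => k _; ring.
Qed.

Section Estimate.
Variables (R : realType) (a b : R) (gamma : R -> R * R) (L : R).
Hypothesis ab : a < b.
Hypothesis cg : {within `[a, b], continuous gamma}.
Hypothesis closed_gamma : gamma a = gamma b.
Hypothesis hL : curve_length a b gamma = L%:E.
Variable f : R -> R.
Hypothesis f_ge : forall th t, a <= t <= b -> height th (gamma t - gamma a) <= f th.
Hypothesis f_att :
  forall th, exists2 t, a <= t <= b & height th (gamma t - gamma a) = f th.
Let E := enclosed_region a b gamma.

Lemma support_ge0 th : 0 <= f th.
Proof.
have /= := @f_ge th a; rewrite subrr lexx ltW // => /(_ isT).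
by rewrite /height !mul0r addr0.
Qed.

Lemma support_periodic th n : f (th + n%:R * (2 * pi)) = f th.
Proof.
have le x m : f (x + m%:R * (2 * pi)) <= f x.
  have [t tab <-] := f_att (x + m%:R * (2 * pi)).
  by rewrite /height cos_per sin_per f_ge.
apply/eqP; rewrite eq_le le /=.
have [t tab <-] := f_att th.
apply: le_trans (f_ge _ tab).
by rewrite /height cos_per sin_per.
Qed.

(** The unit vectors of angles th - x and th + x add up to 2 cos x times the unit
    vector of angle th. *)
Lemma support_sublinear th x : 2 * cos x * f th <= f (th - x) + f (th + x).
Proof.
have [t tab <-] := f_att th.
have := f_ge (th - x) tab; have := f_ge (th + x) tab.
rewrite !heightD cosN sinN; lra.
Qed.

Section Grid.
Variable M : nat.
Hypothesis M1 : (1 < M)%N.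
Let N := (2 * M)%N.
Let al : R := 2 * pi / N%:R.
Let F k := f (k%:R * al).
Let N0 : (0 < N)%N. Proof. by rewrite /N; lia. Qed.
Let Nal : N%:R * al = 2 * pi.
Proof. by rewrite /al; field; rewrite pnatr_eq0 -lt0n. Qed.

Lemma step_eq : al = pi / M%:R.
Proof. by rewrite /al /N natrM; field; rewrite pnatr_eq0 -lt0n ltnW. Qed.

Lemma step_gt0 : 0 < al.
Proof. by rewrite divr_gt0 ?ltr0n // mulr_gt0 ?pi_gt0. Qed.

Lemma step_le : al <= pi / 2.
Proof. by rewrite step_eq ler_pM2l ?pi_gt0 // lef_pV2 ?posrE ?ltr0n ?ler_nat // ltnW. Qed.

Lemma sin_step_gt0 : 0 < sin al.
Proof.
apply: sin_gt0_pi; rewrite step_gt0 (le_lt_trans step_le) //.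
by have := @pi_gt0 R; lra.
Qed.

Lemma support_cyclic : cyclic N F.
Proof. by move=> k; rewrite /F natrD mulrDl Nal -[2 * pi]mul1r (support_periodic _ 1). Qed.

(** The triangulation divides by the support numbers, and f may vanish, since
    the base point lies on the curve; hence the shift by e. *)
Lemma area_le_support_grid e : 0 < e ->
  (area E <= ((autocorr N F 1 - cos al * autocorr N F 0) / sin al +
    (2 * (1 - cos al) * (\sum_(k < N) F k) / sin al) * e +
    (N%:R * (1 - cos al) / sin al) * e ^+ 2)%:E)%E.
Proof.
move=> e0; have sal := sin_step_gt0.
have cF := support_cyclic.
have mE : measurable E by apply: open_measurable_plane; exact: enclosed_open.
have := @area_polygon_le R M (fun k => F k + e) (gamma a) E M1.
rewrite -/N -/al => /(_ _ _ _ mE _); rewrite !autocorr_addc //.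
set X := ((_ - _) / _) => H.
rewrite [Y in (_ <= Y%:E)%E](_ : _ = X); last by rewrite /X; field; rewrite gt_eqF.
apply: H.
- by move=> k; rewrite cF.
- by move=> k; rewrite ltr_wpDl // support_ge0.
- move=> k; have := support_sublinear (k.+1%:R * al) al.
    have -> : k.+1%:R * al - al = k%:R * al by rewrite -natr1; ring.
    have -> : k.+1%:R * al + al = k.+2%:R * al by rewrite -[k.+2%:R]natr1; ring.
    rewrite -/(F _) -/(F _) -/(F _).
    have := ler_wpM2r (ltW e0) (cos_le1 al); lra.
- move=> p Ep k; have : height (k%:R * al) p <= F k + height (k%:R * al) (gamma a).
      apply: (enclosed_height _ Ep) => t tab; rewrite -lerBlDr -heightB; exact: f_ge.
    rewrite heightB; lra.
Qed.

End Grid.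

(** A circumscribed rectangle, from the grid of four directions, bounds the area. *)
Lemma area_real : exists2 A : R, 0 <= A & area E = A%:E.
Proof.
have := area_le_support_grid (isT : (1 < 2)%N) ltr01.
have : (0 <= area E)%E by apply: integral_ge0.
case: (area E) => [r| |] //; by exists r.
Qed.

(** The area is bounded by the quadratic form of the support numbers, the form
    by its mean part minus the spectral gap times the remainder, and the mean part
    by the length.  The powers of sin (al / 2) cancel: 1 - cos al is
    2 sin (al / 2) ^ 2, and [curve_perimeter] bounds 2 sin (al / 2) times the
    sum of f. *)
Lemma isoperimetric_gap M A : (1 < M)%N -> area E = A%:E ->
  let N := (2 * M)%N in let al := 2 * pi / N%:R in
  exists c u v : R, 2 * N%:R * (sin al * A + (cos al - cos (2 * al)) *
      \sum_(k < N) (f (k%:R * al) -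
         (c + u * cos (k%:R * al) + v * sin (k%:R * al))) ^+ 2) <= L ^+ 2.
Proof.
move=> M1 AE N al.
have cF := support_cyclic M1; have sal := sin_step_gt0 M1.
pose F k := f (k%:R * al).
have N4 : (4 <= N)%N by rewrite /N; lia.
have Np : 0 < N%:R :> R by rewrite ltr0n; lia.
have c1 := cos_le1 al.
have S0 : 0 <= \sum_(k < N) F k by apply: sumr_ge0 => k _; exact: support_ge0.
have hA : A <= (autocorr N F 1 - cos al * autocorr N F 0) / sin al.
  apply: (@le_of_quadratic _ _ _ (2 * (1 - cos al) * (\sum_(k < N) F k) / sin al)
      (N%:R * (1 - cos al) / sin al)).
  - by rewrite divr_ge0 ?(ltW sal) // !mulr_ge0 // subr_ge0.
  - by rewrite divr_ge0 ?(ltW sal) // mulr_ge0 ?(ltW Np) // subr_ge0.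
  - by move=> e e0; rewrite -lee_fin -AE; exact: area_le_support_grid.
have gap := fourier_gap cF N4; have res := fourier_residual F N4.
move: gap res; rewrite -/N -/al /= => gap res.
set S := \sum_(k < N) F k in gap res S0.
set u := \sum_(k < N) F k * cos _ in gap res.
set v := \sum_(k < N) F k * sin _ in gap res.
exists (S / N%:R), (2 * u / N%:R), (2 * v / N%:R).
rewrite res in gap.
set G := \sum_(k < N) _ in gap.
have -> : \sum_(k < N) (f (k%:R * al) - (S / N%:R + 2 * u / N%:R * cos (k%:R * al)
    + 2 * v / N%:R * sin (k%:R * al))) ^+ 2 = G.
  by apply: eq_bigr => k _; rewrite /F; congr (_ ^+ 2); field; rewrite gt_eqF.
have per := curve_perimeter ab closed_gamma hL (ltnW M1) f_att.
rewrite -(step_eq M1) -/N -/al in per.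
have L2 : (1 - cos al) * S ^+ 2 * 2 <= L ^+ 2.
  have sh : 0 <= sin (al / 2).
    apply: sin_ge0_pi; have := step_gt0 M1; have := step_le M1; rewrite -/N -/al; lra.
  have -> : 1 - cos al = 2 * sin (al / 2) ^+ 2.
    have -> : cos al = cos ((al / 2) *+ 2) by congr cos; rewrite mulr2n; field.
    by rewrite cos_mulr2n cos2sin2; ring.
  have -> : 2 * sin (al / 2) ^+ 2 * S ^+ 2 * 2 = (2 * sin (al / 2) * S) ^+ 2 by ring.
  have h0 : 0 <= 2 * sin (al / 2) * S by rewrite !mulr_ge0.
  by rewrite ler_pXn2r // ?nnegrE // (le_trans h0).
move: hA; rewrite ler_pdivlMr // => hA.
have : N%:R * (A * sin al) <= N%:R * (autocorr N F 1 - cos al * autocorr N F 0).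
  by rewrite ler_pM2l.
lra.
Qed.

End Estimate.

(** * Bounds for small angles *)

Section TrigBounds.
Variable R : realType.
Implicit Types x y : R.

Lemma ge0_of_derive (g dg : R -> R) : (forall x, is_derive x 1 g (dg x)) ->
  (forall x, 0 <= x -> 0 <= dg x) -> g 0 = 0 -> forall x, 0 <= x -> 0 <= g x.
Proof.
move=> gD dg0 g0 x x0.
have cg : {within `[0, x], continuous g}.
  apply: continuous_subspaceT => y; apply: differentiable_continuous.
  by apply/derivable1_diffP; exact: (@ex_derive _ _ _ _ _ _ _ (gD y)).
have [z zx] := MVT_segment x0 (fun y _ => gD y) cg.
rewrite g0 !subr0 => ->; rewrite mulr_ge0 // dg0 //.
by move: zx; rewrite ?in_itv /= => /andP[].
Qed.

Lemma sin_le_id x : 0 <= x -> sin x <= x.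
Proof.
move=> x0; rewrite -subr_ge0.
apply: (@ge0_of_derive (fun x => x - sin x) (fun x => 1 - cos x)); last exact: x0.
- by move=> y _; rewrite subr_ge0 cos_le1.
- by rewrite sin0 subr0.
Qed.

Lemma abs_sin_le x : `|sin x| <= `|x|.
Proof.
have H y : 0 <= y -> `|sin y| <= y.
  move=> y0; rewrite ler_norml sin_le_id // andbT.
  have [yp|py] := leP y pi; first by rewrite (le_trans _ (sin_ge0_pi _)) ?oppr_le0 ?y0.
  rewrite (le_trans _ (sin_geN1 y)) // lerN2 (le_trans _ (ltW py)) //.
  by rewrite (le_trans _ (pi_ge2 R)) // ler1n.
have [x0|x0] := leP 0 x; first by rewrite (ger0_norm x0) H.
by rewrite -normrN -sinN (ltr0_norm x0) H // oppr_ge0 ltW.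
Qed.

Lemma cos_ge_parabola x : 1 - x ^+ 2 / 2 <= cos x.
Proof.
have -> : cos x = 1 - 2 * sin (x / 2) ^+ 2.
  have -> : cos x = cos ((x / 2) *+ 2) by congr cos; rewrite mulr2n; field.
  by rewrite cos_mulr2n cos2sin2; ring.
have : `|sin (x / 2)| ^+ 2 <= `|x / 2| ^+ 2 by rewrite ler_pXn2r ?nnegrE // abs_sin_le.
rewrite !real_normK ?num_real //.
have -> : (x / 2) ^+ 2 = x ^+ 2 / 4 by field.
lra.
Qed.

Lemma sin_ge_cubic x : 0 <= x -> x - x ^+ 3 / 6 <= sin x.
Proof.
move=> x0; rewrite -subr_ge0.
apply: (@ge0_of_derive (fun x => sin x - (x - x ^+ 3 / 6))
   (fun x => cos x - (1 - x ^+ 2 / 2))); last exact: x0.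
- by move=> y; apply: is_derive_eq; rewrite /GRing.scale /=; field.
- by move=> y _; rewrite subr_ge0 cos_ge_parabola.
- by rewrite sin0 expr0n /= mul0r subrr subr0.
Qed.

Lemma cos_lip x y : `|cos x - cos y| <= `|x - y|.
Proof.
have -> : cos x - cos y = 2 * (- sin ((x + y) / 2) * sin ((x - y) / 2)).
  have -> : cos x = cos ((x + y) / 2 + (x - y) / 2) by congr cos; field.
  have -> : cos y = cos ((x + y) / 2 - (x - y) / 2) by congr cos; field.
  by rewrite cosD cosB; ring.
rewrite !normrM normrN (ger0_norm (ler0n _ 2)).
have -> : `|x - y| = 2 * (1 * `|(x - y) / 2|).
  by rewrite normrM (ger0_norm (_ : 0 <= 2^-1)) ?invr_ge0 //; field.
rewrite ler_pM2l // ler_pM ?sin_max ?abs_sin_le //.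
Qed.

Lemma sin_lip x y : `|sin x - sin y| <= `|x - y|.
Proof.
rewrite -!cosBpihalf; apply: le_trans (cos_lip _ _) _.
by have -> : x - pi / 2 - (y - pi / 2) = x - y by ring.
Qed.

Lemma near_grid_angle (al x : R) : 0 < al -> 0 <= x ->
  exists k : nat, `|x - k%:R * al| <= al.
Proof.
move=> al0 x0; exists (Num.truncn (x / al)).
have := truncn_itv (divr_ge0 x0 (ltW al0)).
rewrite ler_pdivlMr // ltr_pdivrMr // -[_.+1%:R]natr1 => /andP[h1 h2].
by rewrite ger0_norm; lra.
Qed.

End TrigBounds.

(** * The isoperimetric inequality *)

Section Inequality.
Variables (R : realType) (a b : R) (gamma : R -> R * R) (L : R).
Hypothesis ab : a < b.
Hypothesis cg : {within `[a, b], continuous gamma}.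
Hypothesis closed_gamma : gamma a = gamma b.
Hypothesis hL : curve_length a b gamma = L%:E.
Let E := enclosed_region a b gamma.
Variable A : R.
Hypothesis A0 : 0 <= A.
Hypothesis AE : area E = A%:E.

Lemma length_ge0 : 0 <= L.
Proof.
have ps : itv_partition a b [:: b] by split; rewrite /= ?ab.
apply: le_trans (polygon_length_le hL ps).
by apply: sumr_ge0 => i _; exact: sqrtr_ge0.
Qed.

(** The error al - sin al is of third order, but the spectral gap is of second
    order: their quotient tends to 0, and this determines the equality case. *)
Lemma small_angle (al : R) : 0 < al -> al <= 1 / 2 ->
  al - al ^+ 3 / 6 <= sin al /\ 3 / 8 * al ^+ 2 <= cos al - cos (2 * al).
Proof.
move=> al0 al1; split; first by apply: sin_ge_cubic; exact: ltW.
have -> : cos al - cos (2 * al) = 2 * (sin (3 / 2 * al) * sin (al / 2)).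
  have -> : cos al = cos (3 / 2 * al - al / 2) by congr cos; field.
  have -> : cos (2 * al) = cos (3 / 2 * al + al / 2) by congr cos; field.
  by rewrite cosB cosD; ring.
have half (x : R) : 0 <= x <= 1 -> x / 2 <= sin x.
  move=> /andP[x0 x1]; apply: le_trans (sin_ge_cubic x0).
  have : x ^+ 3 <= x * 1 by rewrite exprS ler_wpM2l // expr_le1.
  lra.
have h1 := half (3 / 2 * al); have h2 := half (al / 2).
have -> : 3 / 8 * al ^+ 2 = 2 * ((3 / 2 * al / 2) * (al / 2 / 2)) by field.
by rewrite ler_pM2l // ler_pM //; lra.
Qed.

(** The number of directions is a multiple of 4, so that 0, pi / 2 and pi belong to
    every grid. *)
Lemma fine_grid (e : R) : 0 < e -> exists m : nat,
  (0 < m)%N /\ 2 * pi / (2 * (2 * m))%:R <= e.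
Proof.
move=> e0; exists (Num.truncn (pi / e)).+1; split => //.
have := truncn_itv (divr_ge0 (pi_ge0 R) (ltW e0)).
rewrite ltr_pdivrMr // => /andP[_ h].
set m := (Num.truncn _).+1 in h *.
have m0 : 0 < m%:R :> R by rewrite ltr0n.
rewrite ler_pdivrMr ?ltr0n // !natrM.
have := mulr_ge0 (ltW m0) (ltW e0); lra.
Qed.

(** When the grid is refined, 2 N sin al tends to 4 pi, while the remainder is
    nonnegative. *)
Theorem isoperimetric_inequality : 4 * pi * A <= L ^+ 2.
Proof.
have [f [f1 f2]] := support_function ab cg (gamma a).
apply: (@le_of_quadratic _ _ _ 0 (pi * A)); rewrite ?mulr_ge0 ?pi_ge0 //.
move=> e e0; rewrite mul0r addr0.
have e'0 : 0 < Num.min e (1 / 2) by rewrite lt_min e0 divr_gt0.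
have [m [m0]] := fine_grid e'0.
rewrite le_min => /andP[ale al2].
have M1 : (1 < 2 * m)%N by lia.
have [c [u [v]]] := isoperimetric_gap ab cg closed_gamma hL f1 f2 M1 AE.
set al := 2 * pi / _ in ale al2 *; set N := (2 * _)%:R in al ale al2 *.
have N0 : 0 < N by rewrite /N ltr0n; lia.
have al0 : 0 < al by apply: divr_gt0 => //; rewrite mulr_gt0 ?pi_gt0.
have Nal : N * al = 2 * pi by rewrite /al mulrC divfK // gt_eqF.
have [s1 s2] := small_angle al0 al2.
set G := \sum_(k < _) _.
have G0 : 0 <= (cos al - cos (2 * al)) * G.
  rewrite mulr_ge0 ?sumr_ge0 // => [|k _]; last exact: sqr_ge0.
  by apply: le_trans s2; rewrite mulr_ge0 ?sqr_ge0.
have hs : N * (al - al ^+ 3 / 6) * A <= N * sin al * A.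
  by rewrite ler_wpM2r // ler_pM2l.
have ha : al ^+ 2 <= e ^+ 2 by rewrite ler_pXn2r ?nnegrE // ltW.
have : N * (al - al ^+ 3 / 6) * A = (2 * pi) * A - (2 * pi) * A * al ^+ 2 / 6.
  by rewrite -Nal; field.
have : pi * A * al ^+ 2 <= pi * A * e ^+ 2 by rewrite ler_wpM2l // mulr_ge0 ?pi_ge0.
have : 0 <= pi * A * al ^+ 2.
  by apply: mulr_ge0; [rewrite mulr_ge0 ?pi_ge0|exact: sqr_ge0].
have : 0 <= N * ((cos al - cos (2 * al)) * G) by rewrite mulr_ge0 // ltW.
lra.
Qed.

Section Equality.
Hypothesis eqA : L ^+ 2 = 4 * pi * A.

(** At equality the whole sum of squares, not only its average, is of order al;
    so each of its terms is small, and pointwise closeness needs no continuity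
    of f. *)
Lemma near_circle f (e : R) :
  (forall th t, a <= t <= b -> height th (gamma t - gamma a) <= f th) ->
  (forall th, exists2 t, a <= t <= b & height th (gamma t - gamma a) = f th) ->
  0 < e -> exists m : nat, (0 < m)%N /\
  let al := 2 * pi / (2 * (2 * m))%:R in al <= e /\
  exists c u v : R, forall k : nat,
   `|f (k%:R * al) - (c + u * cos (k%:R * al) + v * sin (k%:R * al))| <= e.
Proof.
move=> f1 f2 e0.
pose e' := Num.min e (Num.min (1 / 2) (e ^+ 2 / (L ^+ 2 + 1))).
have L1 : 0 < L ^+ 2 + 1 by rewrite ltr_wpDl ?sqr_ge0.
have e'0 : 0 < e' by rewrite !lt_min e0 !divr_gt0 ?exprn_gt0.
have [m [m0]] := fine_grid e'0.
rewrite !le_min => /and3P[ale al2 alL].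
have M1 : (1 < 2 * m)%N by lia.
exists m; split => //; split => //.
have [c [u [v]]] := isoperimetric_gap ab cg closed_gamma hL f1 f2 M1 AE.
set n := (2 * (2 * m))%N; set al := 2 * pi / _ in ale al2 alL *.
have N0 : 0 < n%:R :> R by rewrite ltr0n; lia.
have al0 : 0 < al by apply: divr_gt0 => //; rewrite mulr_gt0 ?pi_gt0.
have Nal : n%:R * al = 2 * pi by rewrite /al mulrC divfK // gt_eqF.
have [s1 s2] := small_angle al0 al2.
set G := \sum_(k < _) _ => gap.
have G0 : 0 <= G by apply: sumr_ge0 => k _; exact: sqr_ge0.
have Gal : G <= L ^+ 2 * al.
  have p0 := pi_gt0 R; have p2 := pi_ge2 R.
  have h1 : sin al * A + (cos al - cos (2 * al)) * G <= al * A.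
    rewrite -(@ler_pM2l _ (4 * pi)) ?mulr_gt0 //.
    have -> : 4 * pi * (al * A) = L ^+ 2 * al by rewrite eqA; ring.
    have -> : 4 * pi = 2 * n%:R * al by rewrite -mulrA Nal; ring.
    by rewrite mulrAC; apply: ler_wpM2r gap; exact: ltW.
  have h2 : (al - al ^+ 3 / 6) * A <= sin al * A by exact: ler_wpM2r.
  have h3 : 3 / 8 * al ^+ 2 * G <= (cos al - cos (2 * al)) * G by exact: ler_wpM2r.
  have h4 : al ^+ 2 * (3 / 8 * G) <= al ^+ 2 * (al * A / 6).
    have -> : al ^+ 2 * (al * A / 6) = al * A - (al - al ^+ 3 / 6) * A by field.
    rewrite mulrA (mulrC (al ^+ 2)) lerBrDr; apply: le_trans h1.
    by rewrite addrC; exact: lerD.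
  have h5 : 3 / 8 * G <= al * A / 6 by move: h4; rewrite ler_pM2l // exprn_gt0.
  have h6 : 0 <= al * A by apply: mulr_ge0 => //; exact: ltW.
  have -> : L ^+ 2 * al = 4 * (al * A * pi) by rewrite eqA; ring.
  have := ler_wpM2l h6 p2; move: (al * A) h5 h6 => z h5 h6; lra.
exists c, u, v => k.
pose g (j : nat) := f (j%:R * al) - (c + u * cos (j%:R * al) + v * sin (j%:R * al)).
have cyc : cyclic n g.
  move=> j; rewrite /g natrD mulrDl Nal -[2 * pi]mul1r.
  by rewrite (support_periodic f1 f2 _ 1) (cos_per _ 1) (sin_per _ 1).
rewrite -/(g k) (cyclic_mod _ cyc).
have kn : (k %% n < n)%N by rewrite ltn_mod !muln_gt0 m0.
have : g (k %% n)%N ^+ 2 <= G.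
  rewrite /G (bigD1 (Ordinal kn)) //= lerDl sumr_ge0 // => i _; exact: sqr_ge0.
move=> gG; rewrite -(@ler_pXn2r _ 2) ?nnegrE // ?(ltW e0) //.
rewrite real_normK ?num_real // (le_trans gG) // (le_trans Gal) //.
have := ler_wpM2l (ltW L1) alL.
have -> : (L ^+ 2 + 1) * (e ^+ 2 / (L ^+ 2 + 1)) = e ^+ 2 by field; rewrite gt_eqF.
have : 0 <= al by exact: ltW.
lra.
Qed.

End Equality.
End Inequality.

(** * The equality case *)

Definition circle_point (R : realType) (o : R * R) (r th : R) : R * R :=
  (o.1 + r * cos th, o.2 + r * sin th).

Lemma edist_circle_point (R : realType) (o : R * R) (r th : R) : 0 <= r ->
  Defs.edist (circle_point o r th) o = r.
Proof.
move=> r0; rewrite /Defs.edist /circle_point /=.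
have -> : (o.1 + r * cos th - o.1) ^+ 2 + (o.2 + r * sin th - o.2) ^+ 2 =
          r ^+ 2 * (cos th ^+ 2 + sin th ^+ 2) by ring.
by rewrite cos2Dsin2 mulr1 sqrtr_sqr ger0_norm.
Qed.

Lemma edist_circleP (R : realType) (o p : R * R) (r : R) : 0 <= r ->
  Defs.edist p o = r <-> exists2 th, 0 <= th <= 2 * pi & p = circle_point o r th.
Proof.
move=> r0; split=> [pr|[th _ ->]]; last exact: edist_circle_point.
rewrite -[Defs.edist p o]/(enorm (p - o)) in pr.
have [th th2 [e1 e2]] := polar (p - o); exists th => //.
rewrite pr in e1 e2; rewrite /circle_point -e1 -e2.
by case: p {pr e1 e2} => x y /=; congr pair; ring.
Qed.

Lemma le_of_small (R : realType) (x y q : R) : 0 <= q ->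
  (forall e, 0 < e -> e <= 1 -> x <= y + q * e) -> x <= y.
Proof.
move=> q0 H; rewrite leNgt; apply/negP => yx.
pose e := Num.min 1 ((x - y) / (2 * (q + 1))).
have e0 : 0 < e by rewrite lt_min ltr01 divr_gt0 ?subr_gt0 // mulr_gt0 //; lra.
have e1 : e <= 1 by rewrite ge_min lexx.
have : e <= (x - y) / (2 * (q + 1)) by rewrite ge_min lexx orbT.
rewrite ler_pdivlMr; last by lra.
have := H e e0 e1; lra.
Qed.

Section EqualityCase.
Variables (R : realType) (a b : R) (gamma : R -> R * R) (L A : R).
Hypothesis ab : a < b.
Hypothesis cg : {within `[a, b], continuous gamma}.
Hypothesis closed_gamma : gamma a = gamma b.
Hypothesis hL : curve_length a b gamma = L%:E.
Hypothesis A0 : 0 <= A.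
Hypothesis AE : area (enclosed_region a b gamma) = A%:E.
Hypothesis eqA : L ^+ 2 = 4 * pi * A.
Variable f : R -> R.
Hypothesis f_ge : forall th t, a <= t <= b -> height th (gamma t - gamma a) <= f th.
Hypothesis f_att :
  forall th, exists2 t, a <= t <= b & height th (gamma t - gamma a) = f th.

(** The coefficients in [near_circle] depend on the grid.  They are determined
    up to the error by the values of f at 0, pi / 2 and pi, which belong to all
    the grids, and can thus be chosen once and for all. *)
Lemma support_near_circle : exists c u v : R, forall e, 0 < e ->
  exists2 al, 0 < al <= e & forall k : nat,
   `|f (k%:R * al) - (c + u * cos (k%:R * al) + v * sin (k%:R * al))| <= e.
Proof.
pose c := (f 0 + f pi) / 2; pose u := (f 0 - f pi) / 2; pose v := f (pi / 2) - c.
exists c, u, v => e e0.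
have e5 : 0 < e / 5 by rewrite divr_gt0.
have [m [m0 [ale [c' [u' [v' H]]]]]] := near_circle ab cg closed_gamma hL A0 AE eqA f_ge f_att e5.
set al := 2 * pi / _ in ale H.
have mp : 0 < m%:R :> R by rewrite ltr0n.
have alE : al = pi / 2 / m%:R by rewrite /al !natrM; field; rewrite gt_eqF.
exists al; first by rewrite alE !divr_gt0 ?pi_gt0 // -alE; lra.
have e1 : m%:R * al = pi / 2 by rewrite alE mulrC divfK // gt_eqF.
have e2 : (2 * m)%:R * al = pi by rewrite natrM -mulrA e1; field.
move=> k; have := H k; have := H 0%N; have := H m; have := H (2 * m)%N.
rewrite e1 e2 mul0r cos0 sin0 cos_pihalf sin_pihalf cospi sinpi.
rewrite !ler_distl => /andP[h1 h1'] /andP[h2 h2'] /andP[h3 h3'].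
set th := k%:R * al => /andP[h4 h4'].
have near (z z' w d : R) : `|z - z'| <= d -> `|w| <= 1 -> z * w <= z' * w + d.
  move=> zd w1; rewrite -lerBlDl -mulrBl (le_trans (ler_norm _)) // normrM.
  by rewrite -[d]mulr1 ler_pM.
(* the errors on c, u and v are at most e / 5, e / 5 and 2 e / 5; together with
   the error of the grid they add up to e *)
have cu : `|u - u'| <= e / 5 by rewrite ler_distl /u; lra.
have cv : `|v - v'| <= e / 5 + e / 5 by rewrite ler_distl /v /c; lra.
have := near u u' (cos th) _ cu (cos_max th); have := near v v' (sin th) _ cv (sin_max th).
rewrite distrC in cu; rewrite distrC in cv.
have := near u' u (cos th) _ cu (cos_max th); have := near v' v (sin th) _ cv (sin_max th).
move: (u * cos th) (u' * cos th) (v * sin th) (v' * sin th) h4 h4' => x1 x2 x3 x4 h4 h4'.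
by rewrite /c => *; apply/andP; split; lra.
Qed.

(** The limit form of f is the support function of a disc.  A point of the curve
    outside the disc would exceed f in the direction of the grid closest to
    its own direction.  Conversely, where the curve almost attains f in a
    direction close to th, it is inside the disc and close to its supporting line,
    hence close to the point of the circle of angle th; the image is closed. *)
Lemma equality_disc : exists o r,
  (forall t, a <= t <= b -> enorm (gamma t - o) <= r) /\
  (forall th, 0 <= th -> curve_image a b gamma (circle_point o r th)).
Proof.
have [c [u [v H]]] := support_near_circle.
pose o : R * R := gamma a + (u, v).
have hE k al t : height (k * al) (gamma t - o) =
    height (k * al) (gamma t - gamma a) - (u * cos (k * al) + v * sin (k * al)).
  by rewrite /o /height /=; ring.
have inD t : a <= t <= b -> enorm (gamma t - o) <= c.
  move=> tab; set p := gamma t - o.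
  apply: (@le_of_small _ _ _ (1 + enorm p / 2)) => [|e e0 e1].
    by rewrite addr_ge0 // divr_ge0 ?enorm_ge0.
  have [al /andP[al0 ale] Hk] := H e e0.
  have [ph /andP[ph0 _] [p1 p2]] := polar p.
  have [k kph] := near_grid_angle al0 ph0.
  have := Hk k; rewrite ler_distl => /andP[_ fk].
  have := f_ge (k%:R * al) tab.
  have hp : height (k%:R * al) p = enorm p * cos (ph - k%:R * al).
    by rewrite /height [in LHS]p1 [in LHS]p2 cosB; ring.
  have : enorm p * (1 - e / 2) <= height (k%:R * al) p.
    rewrite hp ler_wpM2l ?enorm_ge0 // (le_trans _ (cos_ge_parabola _)) // lerD2l lerN2.
    rewrite ler_pM2r ?invr_gt0 // -real_normK ?num_real // expr2.
    have le_e : `|ph - k%:R * al| <= e by exact: le_trans kph ale.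
    by rewrite -[e]mulr1 ler_pM // (le_trans le_e).
  rewrite hE => h1 h2; have : enorm p * (1 - e / 2) <= c + e by lra.
  lra.
exists o, c; split => // th th0; set z := circle_point o c th.
have c0 : 0 <= c.
  by apply: le_trans (enorm_ge0 (gamma a - o)) (inD a _); rewrite lexx ltW.
have ic : closed (curve_image a b gamma) by exact: curve_image_closed.
apply: contrapT => nz.
have [eta eta0 be] := open_contains_box (closed_openC ic) nz.
(* ea controls the distance between the circle points of angles th and k * al,
   eb the distance from gamma t to the latter *)
pose e := Num.min 1 (Num.min (eta / (2 * (c + 1))) (eta ^+ 2 / (8 * (c + 1)))).
have c1 : 0 < c + 1 by lra.
have e0 : 0 < e by rewrite !lt_min ltr01 !divr_gt0 ?exprn_gt0 ?mulr_gt0.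
have ea : c * e < eta / 2.
  have : e <= eta / (2 * (c + 1)) by rewrite !ge_min lexx !orbT.
  by rewrite ler_pdivlMr ?mulr_gt0 //; lra.
have eb : 2 * c * e < (eta / 2) ^+ 2.
  have -> : (eta / 2) ^+ 2 = eta ^+ 2 / 4 by field.
  have : e <= eta ^+ 2 / (8 * (c + 1)) by rewrite !ge_min lexx !orbT.
  by rewrite ler_pdivlMr ?mulr_gt0 //; lra.
have [al /andP[al0 ale] Hk] := H e e0.
have [k kth] := near_grid_angle al0 th0.
have [t tab ft] := f_att (k%:R * al).
set p := gamma t - o.
have hp : c - e <= height (k%:R * al) p.
  by rewrite hE ft; have := Hk k; rewrite ler_distl => /andP[+ _]; lra.
have pc := inD t tab; rewrite -/p in pc.
have : (p.1 - c * cos (k%:R * al)) ^+ 2 + (p.2 - c * sin (k%:R * al)) ^+ 2 <= 2 * c * e.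
  have -> : (p.1 - c * cos (k%:R * al)) ^+ 2 + (p.2 - c * sin (k%:R * al)) ^+ 2 =
    (p.1 ^+ 2 + p.2 ^+ 2) + c ^+ 2 * (cos (k%:R * al) ^+ 2 + sin (k%:R * al) ^+ 2)
     - 2 * c * height (k%:R * al) p by rewrite /height; ring.
  rewrite -sqr_enorm cos2Dsin2 mulr1.
  have : enorm p ^+ 2 <= c ^+ 2 by rewrite ler_pXn2r ?nnegrE ?enorm_ge0.
  have := ler_wpM2l c0 hp; lra.
move=> /le_lt_trans /(_ eb) sq.
have close (x y g g' : R) : x ^+ 2 + y ^+ 2 < (eta / 2) ^+ 2 -> `|g - g'| <= e ->
    `|x + c * (g' - g)| < eta.
  move=> xy gg; have xs : `|x| < eta / 2.
    rewrite -(@ltr_pXn2r _ 2) ?nnegrE ?divr_ge0 ?(ltW eta0) // real_normK ?num_real //.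
    by apply: le_lt_trans xy; rewrite lerDl sqr_ge0.
  have cs : `|c * (g' - g)| <= c * e by rewrite normrM ger0_norm // distrC ler_wpM2l.
  have := ler_normD x (c * (g' - g)); lra.
have ct := le_trans (cos_lip th (k%:R * al)) (le_trans kth ale).
have st := le_trans (sin_lip th (k%:R * al)) (le_trans kth ale).
have /be : `|(gamma t).1 - z.1| < eta.
  have -> : (gamma t).1 - z.1 = p.1 - c * cos (k%:R * al) + c * (cos (k%:R * al) - cos th).
    by rewrite /p /z /=; ring.
  exact: close sq ct.
apply.
  have -> : (gamma t).2 - z.2 = p.2 - c * sin (k%:R * al) + c * (sin (k%:R * al) - sin th).
    by rewrite /p /z /=; ring.
  by rewrite addrC in sq; exact: close sq st.
by exists t; rewrite //= in_itv.
Qed.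

End EqualityCase.

(** * Simple closed curves that cover a circle *)

Lemma circle_point_continuous (R : realType) (o : R * R) (r : R) :
  continuous (circle_point o r).
Proof.
have C (x : R) (g : R -> R) : continuous g -> continuous (fun t => x + r * g t).
  move=> cg t; apply: cvgD; first exact: cvg_cst.
  by apply: cvgM; [exact: cvg_cst|exact: cg].
move=> t.
exact: (@cvg_pair _ _ _ (nbhs t) (nbhs (o.1 + r * cos t)) (nbhs (o.2 + r * sin t))
  _ _ _ _ _ (C o.1 _ (@continuous_cos R) t) (C o.2 _ (@continuous_sin R) t)).
Qed.

Lemma circle_point_eq (R : realType) (o : R * R) (r x y : R) : 0 < r ->
  circle_point o r x = circle_point o r y -> cos (x - y) = 1.
Proof.
move=> r0 [/addrI e1 /addrI e2]; have rn : r != 0 by rewrite gt_eqF.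
by rewrite cosB (mulfI rn e1) (mulfI rn e2) -!expr2 cos2Dsin2.
Qed.

Lemma cos_neq1 (R : realType) (x : R) : 0 < x < 2 * pi -> cos x <> 1.
Proof.
move=> /andP[x0 x2] cx.
have : 0 < sin (x / 2) by apply: sin_gt0_pi; rewrite divr_gt0 //= ltr_pdivrMr // mulrC.
have : cos x = cos ((x / 2) *+ 2) by congr cos; rewrite mulr2n; field.
rewrite cos_mulr2n cos2sin2 cx => h s0.
have : 0 < sin (x / 2) ^+ 2 by rewrite exprn_gt0.
lra.
Qed.

Section SimpleCircle.
Variables (R : realType) (a b : R) (gamma : R -> R * R).
Hypothesis ab : a < b.
Hypothesis cg : {within `[a, b], continuous gamma}.
Hypothesis closed_gamma : gamma a = gamma b.
Hypothesis inj_gamma : {in `[a, b[ &, injective gamma}.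
Variables (o : R * R) (r : R).
Hypothesis r0 : 0 < r.
Hypothesis circle_sub : forall th, 0 <= th -> curve_image a b gamma (circle_point o r th).

Lemma inj_half x y : a <= x < b -> a <= y < b -> gamma x = gamma y -> x = y.
Proof. by move=> xab yab; apply: inj_gamma; rewrite in_itv. Qed.

Lemma half_preimage p : curve_image a b gamma p -> exists2 x, a <= x < b & gamma x = p.
Proof.
move=> [x]; rewrite /= ?in_itv /= => /andP[ax xb] <-.
move: xb; rewrite le_eqVlt => /orP[/eqP ->|xb]; last by exists x; rewrite ?ax.
by exists a; rewrite ?lexx.
Qed.

Lemma closed_subarc (c d : R) : a <= c -> d <= b -> closed (gamma @` `[c, d]).
Proof.
move=> ac db; apply: compact_closed; first exact: norm_hausdorff.
apply: continuous_compact; last exact: segment_compact.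
apply: continuous_subspaceW cg => x /=; rewrite !in_itv /= => /andP[cx xd].
by rewrite (le_trans ac cx) (le_trans xd db).
Qed.

Section MissingTime.
Variable t0 : R.
Hypothesis t0ab : a <= t0 < b.
Hypothesis t0_off : forall th, 0 <= th -> gamma t0 <> circle_point o r th.

(** The cyclic order of the parameters, cut at t0 *)
(** The cyclic order of the times, cut at t0. *)
Let pos x := if t0 < x then x - t0 else x - t0 + (b - a).
Let on x := a <= x < b /\ (exists2 th, 0 <= th <= 2 * pi & gamma x = circle_point o r th).

(** The times s and t0 cut the curve into two closed arcs, which meet only at
    gamma s and gamma t0, and gamma t0 is not on the circle.  The circle without
    the point gamma s is connected, so it lies in one of the arcs. *)
Lemma one_side s : on s -> (forall x, on x -> x <> s -> pos x < pos s) \/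
  (forall x, on x -> x <> s -> pos s < pos x).
Proof.
move=> [sab [ph ph2 sE]]; have /andP[ph0 ph1] := ph2.
have /andP[s1 s2] := sab; have /andP[u1 u2] := t0ab.
have st : s <> t0 by move=> e; apply: (t0_off ph0); rewrite -e.
pose lo := Num.min s t0; pose hi := Num.max s t0.
have lohi : (lo = s /\ hi = t0 /\ s < t0) \/ (lo = t0 /\ hi = s /\ t0 < s).
  rewrite /lo /hi; have [h|h|h] := ltgtP s t0; [left|right|] => //.
have [alo hib lh] : [/\ a <= lo, hi < b & lo < hi].
  by case: lohi => [[-> [-> h]]|[-> [-> h]]]; split; lra.
pose F1 := gamma @` `[lo, hi]; pose F2 := gamma @` `[a, lo] `|` gamma @` `[hi, b].
pose D := circle_point o r @` `]ph, (ph + 2 * pi)[.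
have cD : connected D.
  apply: connected_continuous_connected; first exact/connected_intervalP/interval_is_interval.
  by apply: continuous_subspaceT; exact: circle_point_continuous.
have cF1 : closed F1 by apply: closed_subarc => //; exact: ltW.
have cF2 : closed F2.
  by apply: closedU; apply: closed_subarc => //; lra.
have Ds : ~ D (gamma s).
  rewrite sE => -[x]; rewrite /= ?in_itv /= => /andP[x1 x2] /(circle_point_eq r0).
  by apply: cos_neq1; lra.
have Dt : ~ D (gamma t0).
  move=> [x]; rewrite /= ?in_itv /= => /andP[x1 x2] /esym; apply: t0_off.
  by rewrite (le_trans ph0) // ltW.
have F12 p : F1 p -> F2 p -> ~ D p.
  move=> [x]; rewrite /= ?in_itv /= => /andP[x1 x2] xp F2p.
  suff h : x = s \/ x = t0 by case: h => e; rewrite -xp e; [exact: Ds|exact: Dt].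
  suff h : x = lo \/ x = hi.
    by case: lohi => -[l1 [l2 _]]; case: h => ->; rewrite ?l1 ?l2; tauto.
  case: F2p => -[y]; rewrite /= ?in_itv /= => /andP[y1 y2] yp.
    left; apply/eqP; rewrite eq_le x1 andbT.
    by rewrite (inj_half _ _ (etrans xp (esym yp))) //; lra.
  move: y2; rewrite le_eqVlt => /orP[/eqP yb|yb].
    left; apply/eqP; rewrite eq_le x1 andbT.
    rewrite (_ : x = a) //; apply: inj_half; [lra|lra|].
    by rewrite xp -yp yb.
  right; apply/eqP; rewrite eq_le x2 /=.
  by rewrite (inj_half _ _ (etrans xp (esym yp))) //; lra.
have DF : D `<=` (D `&` F1) `|` (D `&` F2).
  move=> p Dp; have : curve_image a b gamma p.
    case: Dp => th; rewrite /= ?in_itv /= => /andP[h _] <-; apply: circle_sub.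
    by rewrite (le_trans ph0) // ltW.
  move=> [x]; rewrite /= ?in_itv /= => /andP[ax xb] xp.
  have [xlo|lox] := leP x lo.
    by right; split => //; left; exists x; rewrite //= in_itv /= ax xlo.
  have [xhi|hix] := leP x hi.
    by left; split => //; exists x; rewrite //= in_itv /= (ltW lox).
  by right; split => //; right; exists x; rewrite //= in_itv /= (ltW hix).
have sep : separated (D `&` F1) (D `&` F2).
  split; rewrite -subset0 => p [].
    move=> cl [Dp F2p]; apply: (F12 p) => //.
    by rewrite [F1](closure_id _).1 //; apply: closureS cl; exact: subIsetr.
  move=> [Dp F1p] cl; apply: (F12 p) => //.
  by rewrite [F2](closure_id _).1 //; apply: closureS cl; exact: subIsetr.
have onD x : on x -> x <> s -> D (gamma x).
  move=> [xab [ps /andP[ps0 ps1] xE]] xs.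
  have ne : circle_point o r ps <> circle_point o r ph.
    by rewrite -xE -sE => /(inj_half xab sab).
  have per th : circle_point o r (th + 2 * pi) = circle_point o r th.
    by rewrite /circle_point -[2 * pi]mul1r (cos_per _ 1) (sin_per _ 1).
  have [h|h|h] := ltgtP ps ph; last by case: ne; rewrite h.
    exists (ps + 2 * pi); last by rewrite per.
    rewrite /= in_itv /= ltrD2r h andbT lt_neqAle; apply/andP; split; last lra.
    by apply/eqP => e; apply: ne; rewrite e per.
  exists ps => //; rewrite /= in_itv /= h /= lt_neqAle; apply/andP; split; last lra.
  by apply/eqP => e; apply: ne; rewrite e per.
have xt x : on x -> x <> t0.
  by move=> [_ [th /andP[th0 _] xE]] e; apply: (t0_off th0); rewrite -e.
have inF1 x : on x -> F1 (gamma x) -> lo <= x <= hi.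
  move=> [xab _] [y]; rewrite /= ?in_itv /= => yb /inj_half <- //.
  by case/andP: yb => y1 y2; lra.
have inF2 x : on x -> F2 (gamma x) -> x <= lo \/ hi <= x.
  move=> [xab _] [[y]|[y]]; rewrite /= ?in_itv /= => /andP[y1 y2].
    by move=> /inj_half <- //; [left|lra].
  move: y2; rewrite le_eqVlt => /orP[/eqP ->|yb /inj_half <- //].
    by rewrite -closed_gamma => /inj_half <- //; [left|rewrite lexx].
    by right.
  by lra.
have [DA|DA] := connected_subset sep DF cD.
  have H x : on x -> x <> s -> lo < x < hi.
    move=> ox xs; have [_ /(inF1 x ox)] := DA _ (onD x ox xs).
    have := xt x ox; case: lohi => -[-> [-> _]] /eqP h1 /andP[h2 h3]; move/eqP: xs => xs.
      by rewrite !lt_neqAle h2 h3 eq_sym xs h1.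
    by rewrite !lt_neqAle h2 h3 (eq_sym t0) xs h1.
  case: lohi => -[l1 [l2 l3]]; [right|left] => x ox xs; have := H x ox xs; rewrite l1 l2 /pos.
    by move=> /andP[h1 h2]; rewrite !ifF; [lra|apply/negbTE; rewrite -leNgt ltW..].
  by move=> /andP[h1 h2]; rewrite !ifT //; lra.
have H x : on x -> x <> s -> x < lo \/ hi < x.
  move=> ox xs; have [_ /(inF2 x ox)] := DA _ (onD x ox xs).
  have /eqP h1 := xt x ox; move/eqP: xs => xs.
  by case: lohi => -[-> [-> _]] [] h2; [left|right|left|right];
    rewrite lt_neqAle h2 ?xs ?h1 // eq_sym ?xs ?h1.
case: lohi => -[l1 [l2 l3]]; [left|right] => x ox xs; have := H x ox xs; rewrite l1 l2 /pos;
  have [xab _] := ox => -[h|h].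
- by rewrite !ifF; [lra|apply/negbTE; rewrite -leNgt; lra..].
- by rewrite ifT // ifF; [lra|apply/negbTE; rewrite -leNgt; lra].
- by rewrite ifT // ifF; [lra|apply/negbTE; rewrite -leNgt; lra].
- by rewrite !ifT //; lra.
Qed.

(** Of three points of the circle one is visited between the other two, which
    [one_side] excludes. *)
Lemma missing_time_absurd : False.
Proof.
have pt th : 0 <= th <= 2 * pi -> exists2 x, on x & gamma x = circle_point o r th.
  move=> th2; have /andP[th0 _] := th2.
  have [x xab xE] := half_preimage (circle_sub th0).
  by exists x => //; split => //; exists th.
have p0 := pi_gt0 R.
have [x1 o1 e1] : exists2 x, on x & gamma x = circle_point o r 0 by apply: pt; lra.
have [x2 o2 e2] : exists2 x, on x & gamma x = circle_point o r (pi / 2) by apply: pt; lra.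
have [x3 o3 e3] : exists2 x, on x & gamma x = circle_point o r pi by apply: pt; lra.
have n12 : x2 <> x1.
  by move=> e; move: e2; rewrite e e1 => /esym/(circle_point_eq r0); apply: cos_neq1; lra.
have n13 : x3 <> x1.
  by move=> e; move: e3; rewrite e e1 => /esym/(circle_point_eq r0); apply: cos_neq1; lra.
have n23 : x3 <> x2.
  by move=> e; move: e3; rewrite e e2 => /esym/(circle_point_eq r0); apply: cos_neq1; lra.
case: (one_side o1) => h1; have := h1 _ o2 n12; have := h1 _ o3 n13;
case: (one_side o2) => h2; have := h2 _ o3 n23; have := h2 _ o1 (nesym n12);
case: (one_side o3) => h3; have := h3 _ o1 (nesym n13); have := h3 _ o2 (nesym n23); lra.
Qed.

End MissingTime.

Lemma simple_curve_on_circle : curve_image a b gamma = [set p | Defs.edist p o = r].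
Proof.
apply/seteqP; split=> [p /half_preimage[t tab <-]|p /=].
  apply: contrapT => tC; apply: (missing_time_absurd tab) => th th0 e; apply: tC.
  by rewrite /= e edist_circle_point // ltW.
by move=> /(edist_circleP _ _ (ltW r0))[th /andP[th0 _] ->]; exact: circle_sub.
Qed.

End SimpleCircle.

(** * The area of a disc *)

Section DiscArea.
Variable R : realType.
Local Notation mu := (@lebesgue_measure R).
Variables (o : R * R) (r : R).
Hypothesis r0 : 0 < r.

Let y (x : R) : R := (x - o.1) / r.
Let half_chord (x : R) : R := r * cos (asin (y x)).
(** With asin (y x) as the angle, half_chord is half the length of the chord of
    abscissa x, and prim is an antiderivative of the length of the chord. *)
Let prim (x : R) : R := r ^+ 2 * (asin (y x) + sin (asin (y x)) * cos (asin (y x))).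

Lemma prim_derive (x : R) : -1 < y x < 1 -> is_derive x 1 prim (2 * half_chord x).
Proof.
move=> y1; have /andP[yl yr] := y1.
have Dy : is_derive x 1 y (1 / r).
  by apply: is_derive_eq; rewrite /GRing.scale /=; field; rewrite gt_eqF.
have Da : is_derive x 1 (asin \o y) ((Num.sqrt (1 - y x ^+ 2))^-1 * (1 / r)).
  by apply: is_derive1_comp; exact: is_derive1_asin.
pose g th : R := r ^+ 2 * (th + sin th * cos th).
have Dg (th : R) : is_derive th 1 g (r ^+ 2 * (1 + (cos th ^+ 2 - sin th ^+ 2))).
  by apply: is_derive_eq; rewrite /GRing.scale /=; ring.
have -> : prim = g \o (asin \o y) by [].
have cn : cos (asin (y x)) = Num.sqrt (1 - y x ^+ 2) by rewrite cos_asin // !ltW.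
have c0 : 0 < cos (asin (y x)).
  by apply: cos_gt0_pihalf; rewrite asin_gtNpi2 ?asin_ltpi2 // ?yl ?yr ?(ltW yl) ?(ltW yr).
have := is_derive1_comp (Dg (asin (y x))) Da.
rewrite -cn /half_chord.
have -> // : r ^+ 2 * (1 + (cos (asin (y x)) ^+ 2 - sin (asin (y x)) ^+ 2)) *
   ((cos (asin (y x)))^-1 * (1 / r)) = 2 * (r * cos (asin (y x))).
by rewrite sin2cos2; field; rewrite !gt_eqF.
Qed.

(** The chords are integrated for abscissas at distance at most r sin ph from the
    centre only, where asin is differentiable; ph can be taken close to
    pi / 2. *)
Lemma disc_area_ge (E : set (R * R)) (ph : R) : measurable E ->
  (forall p, (p.1 - o.1) ^+ 2 + (p.2 - o.2) ^+ 2 < r ^+ 2 -> E p) ->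
  0 < ph < pi / 2 -> ((2 * r ^+ 2 * ph)%:E <= area E)%E.
Proof.
move=> mE discE /andP[ph0 ph1].
have s0 : 0 < sin ph by apply: sin_gt0_pihalf; rewrite ph0.
have s1 : sin ph < 1.
  by have p0 := pi_gt0 R; rewrite -(@sin_pihalf R) ltr_sin ?in_itv /=; lra.
pose t := r * sin ph; have t0 : 0 < t by rewrite mulr_gt0.
pose lo := o.1 - t; pose hi := o.1 + t.
have lohi : lo < hi by rewrite /lo /hi; lra.
have yE (x : R) : lo <= x <= hi -> - sin ph <= y x <= sin ph.
  by rewrite /lo /hi /y /t ler_pdivlMr // ler_pdivrMr //; lra.
have y1 (x : R) : lo <= x <= hi -> -1 < y x < 1 by move/yE; lra.
have ylo : asin (y lo) = - ph.
  have -> : y lo = sin (- ph) by rewrite sinN /y /lo /t; field; rewrite gt_eqF.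
  by rewrite sinK // in_itv /=; apply/andP; split; lra.
have yhi : asin (y hi) = ph.
  have -> : y hi = sin ph by rewrite /y /hi /t; field; rewrite gt_eqF.
  by rewrite sinK // in_itv /=; apply/andP; split; lra.
have ch (x : R) : lo <= x <= hi -> {for x, continuous (fun x => 2 * half_chord x)}.
  move=> xl; apply: cvgM; first exact: cvg_cst.
  apply: cvgM; first exact: cvg_cst.
  apply: (@continuous_comp _ _ _ (asin \o y) (@cos R)); last exact: continuous_cos.
  apply: (@continuous_comp _ _ _ y (@asin R)); last by apply: continuous_asin; exact: y1.
  apply: cvgM; last exact: cvg_cst.
  by apply: cvgB; [exact: cvg_id|exact: cvg_cst].
have cprim (x : R) : lo <= x <= hi -> {for x, continuous prim}.
  move=> xl; apply: differentiable_continuous; apply/derivable1_diffP.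
  exact: (@ex_derive _ _ _ _ _ _ _ (prim_derive (y1 x xl))).
have wch : {within `[lo, hi], continuous (fun x => 2 * half_chord x)}.
  by apply: continuous_in_subspaceT => x; rewrite inE /= ?in_itv /=; exact: ch.
have half_chord_ge0 (x : R) : lo <= x <= hi -> 0 <= half_chord x.
  move=> /y1 /andP[yl yr]; rewrite /half_chord mulr_ge0 ?(ltW r0) // cos_ge0_pihalf //.
  by rewrite asin_geNpi2 ?asin_lepi2 // !ltW.
have FTC : (\int[mu]_(x in `[lo, hi]) (2 * half_chord x)%:E = (prim hi - prim lo)%:E)%E.
  rewrite (@continuous_FTC2 _ _ prim _ _ lohi) // ?EFinB //.
    split.
    - move=> x; rewrite in_itv /= => /andP[/ltW xl /ltW xr].
      by apply: (@ex_derive _ _ _ _ _ _ _ (prim_derive (y1 x _))); rewrite xl.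
    - by apply: cvg_at_right_filter; apply: cprim; rewrite lexx ltW.
    - by apply: cvg_at_left_filter; apply: cprim; rewrite lexx ltW.
  move=> x; rewrite in_itv /= => /andP[/ltW xl /ltW xr].
  rewrite derive1E; have xx : lo <= x <= hi by rewrite xl.
  by have D := prim_derive (y1 x xx); rewrite derive_val.
apply: (@le_trans _ _ (\int[mu]_(x in `[lo, hi]) (2 * half_chord x)%:E)%E).
  rewrite FTC lee_fin /prim yhi ylo sinN cosN.
  have : 0 <= r ^+ 2 * (sin ph * cos ph).
    rewrite mulr_ge0 ?sqr_ge0 // mulr_ge0 ?(ltW s0) // cos_ge0_pihalf //.
    by apply/andP; split; lra.
  lra.
have msec : measurable_fun setT (mu \o xsection E) by exact: measurable_fun_xsection.
rewrite /area /product_measure1.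
apply: (@le_trans _ _ (\int[mu]_(x in `[lo, hi]) (mu \o xsection E) x)%E); last first.
  apply: ge0_subset_integral => //.
apply: ge0_le_integral => //.
- move=> x; rewrite /= ?in_itv /= => xl; rewrite lee_fin mulr_ge0 //; exact: half_chord_ge0.
- by apply/measurable_EFinP; apply: subspace_continuous_measurable_fun.
- by apply: measurable_funTS.
- move=> x; rewrite /= ?in_itv /= => xl.
  have h0 := half_chord_ge0 x xl.
  apply: (@le_trans _ _ (mu `](o.2 - half_chord x), (o.2 + half_chord x)[)).
    rewrite lebesgue_measure_itv /= lte_fin; case: ifPn => [_|].
      by rewrite -EFinB lee_fin; lra.
    by rewrite -leNgt lee_fin => h; lra.
  apply: le_measure; rewrite ?inE //.
    exact: measurable_xsection.
  move=> z; rewrite /= ?in_itv /= => zl; rewrite /xsection /= inE; apply: discE => /=.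
  have -> : x - o.1 = r * y x by rewrite /y; field; rewrite gt_eqF.
  have : (z - o.2) ^+ 2 < half_chord x ^+ 2.
    rewrite -[X in X < _]real_normK ?num_real // ltr_pXn2r ?nnegrE // ltr_distl.
    exact: zl.
  have /andP[yl yr] := y1 x xl.
  have -> : half_chord x ^+ 2 = r ^+ 2 - (r * y x) ^+ 2.
    by rewrite /half_chord exprMn cos2sin2 asinK ?in_itv /= ?(ltW yl) ?(ltW yr) //; ring.
  lra.
Qed.

End DiscArea.

(** * Curves whose image is a circle *)

Section CircleCurve.
Variables (R : realType) (a b : R) (gamma : R -> R * R).
Hypothesis ab : a < b.
Hypothesis cg : {within `[a, b], continuous gamma}.
Hypothesis closed_gamma : gamma a = gamma b.
Hypothesis inj_gamma : {in `[a, b[ &, injective gamma}.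
Variables (o : R * R) (r : R).
Hypothesis r0 : 0 < r.
Hypothesis imE : curve_image a b gamma = [set p | Defs.edist p o = r].

(** The squared distance to o is continuous on the component of p, starts
    below r ^ 2 and never takes this value, so the component stays in the disc. *)
Lemma disc_sub_enclosed p : (p.1 - o.1) ^+ 2 + (p.2 - o.2) ^+ 2 < r ^+ 2 ->
  enclosed_region a b gamma p.
Proof.
move=> pr; pose g (q : R * R) := (q.1 - o.1) ^+ 2 + (q.2 - o.2) ^+ 2.
have g_cont : continuous g.
  have c2 (h : R * R -> R) c : continuous h -> continuous (fun q => (h q - c) ^+ 2).
    move=> ch q; under eq_fun => z do rewrite expr2.
    by apply: cvgM; apply: cvgB; [exact: ch|exact: cvg_cst|exact: ch|exact: cvg_cst].
  move=> q; apply: cvgD.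
    exact: (c2 fst o.1 (@fst_continuous R)).
  exact: (c2 snd o.2 (@snd_continuous R)).
have im q : curve_image a b gamma q -> g q = r ^+ 2.
  rewrite imE /= => <-; rewrite sqr_sqrtr // addr_ge0 ?sqr_ge0 //.
have mi q : g q = r ^+ 2 -> curve_image a b gamma q.
  by rewrite imE /= /Defs.edist -/(g q) => ->; rewrite sqrtr_sqr ger0_norm // ltW.
have np : (~` curve_image a b gamma) p.
  by move=> /im e; move: pr; rewrite -/(g p) e ltxx.
split => //; set K := connected_component _ _.
have gK q : K q -> g q < r ^+ 2.
  move=> Kq; rewrite ltNge; apply/negP => rq.
  have cK : connected (g @` K).
    apply: connected_continuous_connected; first exact: component_connected.
    exact: continuous_subspaceT.
  have /connected_intervalP iK := cK.
  have [z Kz zr] : (g @` K) (r ^+ 2).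
    apply: (iK (g p) (g q)); [|by exists q|by rewrite (ltW pr)].
    by exists p => //; exact: connected_component_refl.
  by have := @connected_component_sub _ _ _ _ Kz; apply; exact: mi.
pose M := `|o.1| + `|o.2| + r.
exists M; split => [|x Mx q Kq]; first exact: num_real.
have coord (u v s : R) : (u - s) ^+ 2 + v ^+ 2 < r ^+ 2 -> `|u| <= `|s| + r.
  move=> uv; have : `|u - s| < r.
    rewrite -(@ltr_pXn2r _ 2) ?nnegrE ?(ltW r0) // real_normK ?num_real //.
    by apply: le_lt_trans uv; rewrite lerDl sqr_ge0.
  have := ler_normD (u - s) s; rewrite subrK; lra.
have h1 := coord _ _ _ (gK q Kq).
have h2 : `|q.2| <= `|o.2| + r by apply: (coord _ (q.1 - o.1)); rewrite addrC; exact: gK.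
rewrite /Num.norm /= ge_max; apply/andP.
by have := normr_ge0 o.1; have := normr_ge0 o.2; rewrite /M in Mx; split; lra.
Qed.

Lemma circle_area A : area (enclosed_region a b gamma) = A%:E -> pi * r ^+ 2 <= A.
Proof.
move=> AE; apply: (@le_of_small _ _ _ (2 * r ^+ 2)); first by rewrite mulr_ge0 ?sqr_ge0.
move=> e e0 e1; have p2 := pi_ge2 R.
have [eh|he] := ltP e (pi / 2).
  have ph : 0 < pi / 2 - e < pi / 2 by lra.
  have mE : measurable (enclosed_region a b gamma).
    by apply: open_measurable_plane; exact: enclosed_open.
  have := disc_area_ge r0 mE disc_sub_enclosed ph.
  rewrite AE lee_fin; lra.
have : (0 <= A%:E)%E by rewrite -AE; apply: integral_ge0.
have : 2 * r ^+ 2 * (pi / 2) <= 2 * r ^+ 2 * e by rewrite ler_wpM2l // mulr_ge0 ?sqr_ge0.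
rewrite lee_fin; lra.
Qed.

Lemma chord_le x y : Defs.edist (circle_point o r x) (circle_point o r y) <= r * `|x - y|.
Proof.
have ge0 : 0 <= r * `|x - y| by rewrite mulr_ge0 // ltW.
rewrite -[leRHS]ger0_norm // -sqrtr_sqr ler_wsqrtr // exprMn real_normK ?num_real //.
rewrite /circle_point /=.
have -> : (o.1 + r * cos x - (o.1 + r * cos y)) ^+ 2 + (o.2 + r * sin x - (o.2 + r * sin y)) ^+ 2
  = r ^+ 2 * (2 - 2 * cos (x - y)).
  transitivity (r ^+ 2 * ((cos x ^+ 2 + sin x ^+ 2) + (cos y ^+ 2 + sin y ^+ 2)
      - 2 * (cos x * cos y + sin x * sin y))); first by ring.
  by rewrite !cos2Dsin2 cosB; ring.
rewrite ler_wpM2l ?sqr_ge0 //; have := cos_ge_parabola (x - y); lra.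
Qed.

Lemma on_circle t : a <= t <= b -> Defs.edist (gamma t) o = r.
Proof.
move=> tab; have : curve_image a b gamma (gamma t) by exists t; rewrite //= in_itv.
by rewrite imE.
Qed.

(** Stereographic projection from gamma a sends the rest of the circle to a line
    by the coordinate s.  Along the curve s is continuous and injective, hence
    monotone; the polar angle, counted from gamma a, is pi + 2 atan s, and sg is
    the orientation of the curve. *)
Lemma monotone_angle : exists (sg c : R) (th : R -> R), [/\ `|sg| = 1,
  forall t, a <= t <= b -> gamma t = circle_point o r (c + sg * th t),
  (forall t u, a <= t <= u -> u <= b -> th t <= th u) & th b - th a = 2 * pi].
Proof.
have aab : a <= a <= b by rewrite lexx ltW.
have /(edist_circleP _ _ (ltW r0))[ph _ aE] := on_circle aab.
pose X t := height ph (gamma t - o) / r.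
pose Y t := (cos ph * (gamma t - o).2 - sin ph * (gamma t - o).1) / r.
have gE t : gamma t = (o.1 + r * (cos ph * X t - sin ph * Y t),
                       o.2 + r * (sin ph * X t + cos ph * Y t)).
  rewrite [LHS]surjective_pairing; congr pair.
    transitivity (o.1 + (cos ph ^+ 2 + sin ph ^+ 2) * ((gamma t).1 - o.1)).
      by rewrite cos2Dsin2; ring.
    by rewrite /X /Y /height /=; field; rewrite gt_eqF.
  transitivity (o.2 + (cos ph ^+ 2 + sin ph ^+ 2) * ((gamma t).2 - o.2)).
    by rewrite cos2Dsin2; ring.
  by rewrite /X /Y /height /=; field; rewrite gt_eqF.
have XY t : a <= t <= b -> X t ^+ 2 + Y t ^+ 2 = 1.
  move=> /on_circle; rewrite -[Defs.edist _ _]/(enorm (gamma t - o)) => tr.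
  transitivity ((cos ph ^+ 2 + sin ph ^+ 2) * (enorm (gamma t - o) ^+ 2) / r ^+ 2).
    by rewrite sqr_enorm /X /Y /height; field; rewrite gt_eqF.
  by rewrite cos2Dsin2 mul1r tr divff // expf_neq0 // gt_eqF.
have Xa : X a = 1.
  rewrite /X aE /height /circle_point /=.
  transitivity (cos ph ^+ 2 + sin ph ^+ 2); last exact: cos2Dsin2.
  by field; rewrite gt_eqF.
have Ya : Y a = 0 by rewrite /Y aE /circle_point /=; field; rewrite gt_eqF.
have X1 t : a < t < b -> X t < 1.
  move=> /andP[ta tb]; have tab : a <= t <= b by rewrite !ltW.
  rewrite lt_neqAle; apply/andP; split; last first.
    rewrite (le_trans (ler_norm _)) // -(@ler_pXn2r _ 2) ?nnegrE // real_normK ?num_real //.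
    by rewrite expr1n -(XY t tab) lerDl sqr_ge0.
  apply/eqP => Xt; have := XY t tab; rewrite Xt expr1n => h.
  have /eqP : Y t ^+ 2 = 0 by lra.
  rewrite sqrf_eq0 => /eqP Yt.
  have /inj_gamma : gamma t = gamma a by rewrite gE (gE a) Xt Yt Xa Ya.
  rewrite !in_itv /= (ltW ta) tb lexx ab => /(_ isT isT) e.
  by move: ta; rewrite e ltxx.
pose s t := - Y t / (1 - X t).
have sX t : a < t < b -> X t = (s t ^+ 2 - 1) / (1 + s t ^+ 2) /\
    Y t = - 2 * s t / (1 + s t ^+ 2).
  move=> tab; have Xt := X1 t tab; have /andP[ta tb] := tab.
  have n1 : 1 - X t != 0 by rewrite subr_eq0 gt_eqF.
  have Yt : Y t ^+ 2 = (1 - X t) * (1 + X t).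
    by have := XY t; rewrite !ltW // => /(_ isT); lra.
  have s2 : s t ^+ 2 = (1 + X t) / (1 - X t).
    by rewrite /s expr_div_n sqrrN Yt; field.
  have n2 : 1 + X t + (1 - X t) != 0 by apply/eqP; lra.
  by rewrite s2 /s; split; field; rewrite n1 /=; apply/eqP; lra.
have cX : {within `]a, b[, continuous s}.
  have sub : `]a, b[ `<=` `[a, b].
    by move=> t; rewrite /= !in_itv /= => /andP[/ltW -> /ltW ->].
  have := continuous_subspaceW sub cg.
  rewrite continuous_open_subspace; last exact: interval_open.
  move=> cg'; apply: continuous_in_subspaceT => t tab.
  have comp (h : R * R -> R) : continuous h -> {for t, continuous (h \o gamma)}.
    by move=> ch; apply: continuous_comp; [exact: cg'|exact: ch].
  have cXY (h : R * R -> R) (x y : R) : continuous h ->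
      {for t, continuous (fun u => (h (gamma u) - x) / y)}.
    move=> ch; apply: cvgM; last exact: cvg_cst.
    by apply: cvgB; [exact: comp|exact: cvg_cst].
  have Xc : {for t, continuous X}.
    rewrite (_ : X = (fun u => (height ph (gamma u) - height ph o) / r)).
      by apply: cXY; exact: height_continuous.
    by apply/funext => u; rewrite /X heightB.
  have Yc : {for t, continuous Y}.
    rewrite (_ : Y = (fun u => (height (ph + pi / 2) (gamma u) - height (ph + pi / 2) o) / r)).
      by apply: cXY; exact: height_continuous.
    by apply/funext => u; rewrite /Y /height cosDpihalf sinDpihalf /=; congr (_ / _); ring.
  apply: cvgM; first by apply: cvgN; exact: Yc.
  apply: cvgV; last by apply: cvgB; [exact: cvg_cst|exact: Xc].
  move: tab; rewrite inE /= ?in_itv /= => /X1 Xt.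
  by rewrite subr_eq0 gt_eqF.
have iX : {in `]a, b[ &, injective s}.
  move=> t u; rewrite !in_itv /= => tab uab tu.
  have [e1 e2] := sX t tab; have [e3 e4] := sX u uab.
  have /inj_gamma : gamma t = gamma u by rewrite gE (gE u) e1 e2 e3 e4 tu.
  by apply; rewrite in_itv /=; [case/andP: tab => /ltW -> ->|case/andP: uab => /ltW -> ->].
have [sg [sgE smono]] : exists sg : R, (sg = 1 \/ sg = -1) /\
    forall t u, a < t < b -> a < u < b -> t <= u -> sg * s t <= sg * s u.
  have [m|m] := itv_continuous_inj_mono cX iX.
    exists 1; split; first by left.
    move=> t u tab uab.
    rewrite !mul1r le_eqVlt => /orP[/eqP -> //|tu].
    by apply: ltW; apply: m; rewrite ?in_itv.
  exists (-1); split; first by right.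
  move=> t u tab uab.
  rewrite !mulN1r lerN2 le_eqVlt => /orP[/eqP -> //|tu].
  by apply: ltW; apply: m; rewrite ?in_itv.
have sg1 : `|sg| = 1 by case: sgE => ->; rewrite ?normrN1 ?normr1.
(* half of the polar angle measured from the point opposite to gamma a; the two
   ends of the interval reach gamma a with opposite signs *)
pose psi t := if t <= a then - (pi / 2) else if b <= t then pi / 2 else atan (sg * s t).
have psib t : - (pi / 2) <= psi t <= pi / 2.
  have p0 := pi_gt0 R; rewrite /psi; case: ifP => _; first by apply/andP; split; lra.
  case: ifP => _; first by apply/andP; split; lra.
  by rewrite !ltW ?atan_ltpi2 ?atan_gtNpi2.
exists sg, (ph + pi), (fun t => 2 * psi t); split => //.
- move=> t /andP[ta tb].
  have per x : circle_point o r (x + 2 * pi) = circle_point o r x.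
    by rewrite /circle_point -[2 * pi]mul1r (cos_per _ 1) (sin_per _ 1).
  have ends (e : R) : e = 1 \/ e = -1 -> circle_point o r (ph + pi + e * pi) = gamma a.
    case=> ->; first by rewrite aE -(per ph); congr circle_point; ring.
    by rewrite mulN1r addrK aE.
  rewrite /psi; case: (leP t a) => ta'.
    have -> : t = a by apply/eqP; rewrite eq_le ta' ta.
    rewrite -[LHS](ends (- sg)); last by case: sgE => ->; [right|left; rewrite opprK].
    by congr circle_point; field.
  case: (leP b t) => tb'.
    have -> : t = b by apply/eqP; rewrite eq_le tb' tb.
    rewrite -closed_gamma -[LHS](ends sg) //.
    by congr circle_point; field.
  have tab : a < t < b by rewrite ta'.
  have [e1 e2] := sX t tab.
  have -> : sg * (2 * atan (sg * s t)) = 2 * atan (s t).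
    by case: sgE => ->; rewrite ?mul1r // !mulN1r atanN; ring.
  rewrite gE /circle_point.
  set w := atan (s t).
  have cw : cos w ^+ 2 = (1 + s t ^+ 2)^-1.
    by rewrite /w cos_atan exprVn sqr_sqrtr // addr_ge0 ?sqr_ge0.
  have cw0 : cos w != 0.
    by rewrite gt_eqF // cos_gt0_pihalf // atan_gtNpi2 atan_ltpi2.
  have sw : sin w = s t * cos w.
    by rewrite -[s t]atanK -/w /tan divfK.
  have n0 : 1 + s t ^+ 2 != 0 by rewrite gt_eqF // ltr_wpDr ?sqr_ge0.
  have Xw : cos (pi + 2 * w) = X t.
    rewrite addrC cosDpi (_ : 2 * w = w *+ 2) ?cos_mulr2n ?mulr2n; last by ring.
    by rewrite cw e1; field.
  have Yw : sin (pi + 2 * w) = Y t.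
    rewrite addrC sinDpi (_ : 2 * w = w *+ 2) ?sin_mulr2n ?mulr2n; last by ring.
    rewrite sw (_ : cos w * (s t * cos w) = s t * cos w ^+ 2); last by ring.
    by rewrite cw e2; field.
  rewrite -(addrA ph) (cosD ph) (sinD ph) Xw Yw; congr pair; ring.
- move=> t u /andP[ta tu] ub; rewrite ler_pM2l //.
  rewrite {1}/psi; case: (leP t a) => ta'; first by case/andP: (psib u).
  case: (leP b t) => tb'.
    by rewrite /psi (leNgt u a) (lt_le_trans ta' tu) /= (le_trans tb' tu).
  rewrite /psi (leNgt u a) (lt_le_trans ta' tu) /=; case: (leP b u) => ub'.
    by rewrite ltW // atan_ltpi2.
  by apply: le_atan; apply: smono => //; rewrite ?ta' ?(lt_le_trans ta' tu).
- by rewrite /psi lexx (leNgt b a) ab /= lexx; field.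
Qed.

(** A chord is at most as long as its arc, and by monotonicity the arcs of an
    inscribed polygon add up to one turn. *)
Lemma circle_length L : curve_length a b gamma = L%:E -> L <= 2 * pi * r.
Proof.
move=> hL; rewrite -lee_fin -hL; apply: ge_ereal_sup => _ [s [ps /eqP ls] <-].
rewrite lee_fin /polygon_length.
have [sg [c [th [sg1 gE mono thab]]]] := monotone_angle.
pose P n := nth b (a :: s) n.
have lb : P (size s) = b by rewrite /P -[RHS]ls -(last_nth b a s).
have Pmono m : (m < size s)%N -> P m <= P m.+1.
  by move=> ms; rewrite ltW //; have /(pathP b) := ps; apply.
have Pmono2 m n : (m <= n)%N -> (n <= size s)%N -> P m <= P n.
  elim: n => [|n IH]; first by rewrite leqn0 => /eqP ->.
  rewrite leq_eqVlt => /orP[/eqP -> //|mn] ns.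
  exact: le_trans (IH mn (ltnW ns)) (Pmono n ns).
have Pab m : (m <= size s)%N -> a <= P m <= b.
  move=> ms; have := Pmono2 m _ ms (leqnn _); rewrite lb => ->.
  by rewrite andbT; exact: (Pmono2 0%N m).
apply: (@le_trans _ _ (\sum_(0 <= n < size s) r * (th (P n.+1) - th (P n)))).
  apply: ler_sum_nat => n /andP[_ ns].
  rewrite /comp -/(P n) -/(P n.+1) gE ?Pab // gE ?Pab ?(ltnW ns) //.
  apply: le_trans (chord_le _ _) _; rewrite ler_pM2l //.
  have -> : c + sg * th (P n.+1) - (c + sg * th (P n)) = sg * (th (P n.+1) - th (P n)) by ring.
  rewrite normrM sg1 mul1r ger0_norm // subr_ge0 mono //.
    by have /andP[-> _] := Pab n (ltnW ns); rewrite Pmono.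
  by have /andP[_ ->] := Pab n.+1 ns.
by rewrite -mulr_sumr telescope_sumr // lb -[P 0%N]/a thab mulrC.
Qed.

End CircleCurve.

(** * The isoperimetric theorem *)

Theorem theorem2p1 (R : realType) (a b : R) (gamma : R -> R * R) (L : R)
    (hab : a < b)
    (hgamma : simple_closed_curve a b gamma)
    (hL : curve_length a b gamma = L%:E) :
  ((4 * pi)%:E * area (enclosed_region a b gamma) <= (L ^+ 2)%:E)%E /\
  ((L ^+ 2)%:E = ((4 * pi)%:E * area (enclosed_region a b gamma))%E <->
   is_circle (curve_image a b gamma)).
Proof.
have [cg closed_gamma inj_gamma] := hgamma.
have [f [f_ge f_att]] := support_function hab cg (gamma a).
have [A A0 AE] := area_real hab cg f_ge f_att.
have ineq := isoperimetric_inequality hab cg closed_gamma hL A0 AE.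
rewrite AE -EFinM lee_fin; split=> //; split.
  move=> [eqA].
  have [z [r [in_disc on_curve]]] :=
    equality_disc hab cg closed_gamma hL A0 AE eqA f_ge f_att.
  exists z, r; suff r0 : 0 < r.
    by split => //; exact: simple_curve_on_circle hab cg closed_gamma inj_gamma _ _ r0 on_curve.
  (* a curve in a disc of radius at most 0 would be constant *)
  rewrite ltNge; apply/negP => r_le0.
  have at_centre t : a <= t <= b -> gamma t = z.
    move=> tab; have n0 : enorm (gamma t - z) = 0.
      by apply/eqP; rewrite eq_le enorm_ge0 andbT (le_trans (in_disc t tab)).
    have [ph _ []] := polar (gamma t - z); rewrite n0 !mul0r /=.
    case: (gamma t) => x y /= /eqP; rewrite subr_eq0 => /eqP -> /eqP.
    by rewrite subr_eq0 => /eqP ->; rewrite -surjective_pairing.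
  have /inj_gamma : gamma a = gamma ((a + b) / 2) by rewrite !at_centre //; lra.
  rewrite !in_itv /= => inj; suff : a = (a + b) / 2 by lra.
  by apply: inj; lra.
move=> [z [r [r0 imE]]].
have hr := circle_area cg r0 imE AE.
have hl := circle_length hab cg closed_gamma inj_gamma r0 imE hL.
congr EFin; apply/eqP; rewrite eq_le ineq andbT.
have L0 := length_ge0 hab hL.
have : L ^+ 2 <= (2 * pi * r) ^+ 2.
  by rewrite ler_pXn2r ?nnegrE //; exact: le_trans hl.
have := ler_wpM2l (pi_ge0 R) hr.
have -> : (2 * pi * r) ^+ 2 = 4 * (pi * (pi * r ^+ 2)) by ring.
lra.
Qed.
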